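(* Let $m\ge1$ be an integer and let $\tilde B,\tilde H\in\Omega_{2n}$ with $\tilde H$ invertible and Hermitian and $\tilde B$ $\tilde H$-selfadjoint. Then there exists an $\tilde H$-selfadjoint $\tilde A\in\Omega_{2n}$ with $\tilde A^m=\tilde B$ if and only if the canonical form of $(\tilde B,\tilde H)$ (up to permutation of blocks) has the following two properties: 1. If $m$ is even, the part $(\tilde B_-,\tilde H_-)$ of the canonical form corresponding to the negative eigenvalues has the form $$\tilde B_-=\bigoplus_{j=1}^t\big(J_{k_j}(\lambda_j)\oplus J_{k_j}(\lambda_j)\big)\oplus\bigoplus_{j=1}^t\big(J_{k_j}(\lambda_j)\oplus J_{k_j}(\lambda_j)\big),\quad \tilde H_-=\bigoplus_{j=1}^t\big(Q_{k_j}\oplus -Q_{k_j}\big)\oplus\bigoplus_{j=1}^t\big(Q_{k_j}\oplus -Q_{k_j}\big)$$ for some $t\ge0$, $k_j\ge1$ and $\lambda_j<0$. (If $m$ is odd, no condition is imposed on the negative eigenvalues.) 2. The part $(\tilde B_0,\tilde H_0)$ of the canonical form corresponding to the eigenvalue $0$ has the form $\tilde B_0=J_B\oplus J_B$, $\tilde H_0=H_B\oplus H_B$ with $$J_B=\bigoplus_{j=1}^t\Big(\bigoplus_{i=1}^{r_j}J_{a_j+1}(0)\oplus\bigoplus_{i=r_j+1}^{m}J_{a_j}(0)\Big),\quad H_B=\bigoplus_{j=1}^t\Big(\bigoplus_{i=1}^{r_j}\varepsilon^{(j)}_iQ_{a_j+1}\oplus\bigoplus_{i=r_j+1}^{m}\varepsilon^{(j)}_iQ_{a_j}\Big),$$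 for some $t\ge0$, integers $a_j\ge0$, $0<r_j\le m$, and signs $\varepsilon_i^{(j)}\in\{1,-1\}$ satisfying: for each $j$ there is $\eta_j\in\{1,-1\}$ such that, among $\varepsilon^{(j)}_1,\dots,\varepsilon^{(j)}_{r_j}$, if $r_j$ is even then half equal $\eta_j$ and half equal $-\eta_j$, and if $r_j$ is odd then exactly one more equals $\eta_j$ than equals $-\eta_j$; and the same rule (with the same $\eta_j$) holds for $\varepsilon^{(j)}_{r_j+1},\dots,\varepsilon^{(j)}_m$ with $m-r_j$ in place of $r_j$. (No conditions are imposed on the parts corresponding to positive or nonreal eigenvalues.)
   Context: $\Omega_{2n}=\{\begin{bmatrix}A_1&\bar A_2\\-A_2&\bar A_1\end{bmatrix}: A_1,A_2\in\mathbb{C}^{n\times n}\}\subset\mathbb{C}^{2n\times 2n}$ (the image of $\mathbb{H}^{n\times n}$ under the standard complex representation). $J_k(\lambda)$: $k\times k$ upper triangular Jordan block; $J_0(0)$ and $Q_0$ are understood as empty (absent) blocks. $Q_k$: $k\times k$ matrix with ones on the anti-diagonal, zeros elsewhere. For invertible Hermitian $H$, $A$ is $H$-selfadjoint if $HA=A^*H$. Canonical form: for $\tilde H\in\Omega_{2n}$ invertible Hermitian and $\tilde B\in\Omega_{2n}$ $\tilde H$-selfadjoint, there is an invertible $S\in\Omega_{2n}$ with $S^{-1}\tilde BS=M\oplus M'$, $S^*\tilde HS=N\oplus N$, where $M=\bigoplus_{i=1}^{\alpha}J_{k_i}(\lambda_i)\oplus\bigoplus_{i=\alpha+1}^{\beta}(J_{k_i}(\lambda_i)\oplus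 J_{k_i}(\bar\lambda_i))$, $M'=\bigoplus_{i=1}^{\alpha}J_{k_i}(\lambda_i)\oplus\bigoplus_{i=\alpha+1}^{\beta}(J_{k_i}(\bar\lambda_i)\oplus J_{k_i}(\lambda_i))$, $N=\bigoplus_{i=1}^\alpha\eta_iQ_{k_i}\oplus\bigoplus_{i=\alpha+1}^\beta Q_{2k_i}$, with $\lambda_1,\dots,\lambda_\alpha$ real, $\lambda_{\alpha+1},\dots,\lambda_\beta$ with positive imaginary part, $\eta_i=\pm1$; it is unique up to permutation of blocks. The ''part corresponding to'' a set of eigenvalues consists of the blocks of $S^{-1}\tilde BS$ with those eigenvalues (in both copies) together with the corresponding blocks of $S^*\tilde HS$. *)

(* Defs.v *)
From HB Require Import structures.
From mathcomp Require Import all_boot all_order all_algebra.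
From mathcomp Require Import reals complex.
Set Implicit Arguments. Unset Strict Implicit. Unset Printing Implicit Defensive.
Import Order.TTheory GRing.Theory Num.Theory.
Local Open Scope ring_scope.

Section QuatDefs.
Variable R : realType.
Local Notation C := (R[i]).

Definition cconj_mx (p q : nat) (A : 'M[C]_(p, q)) : 'M[C]_(p, q) := map_mx (@conjc R) A.
Definition adj_mx (p q : nat) (A : 'M[C]_(p, q)) : 'M[C]_(q, p) := (cconj_mx A)^T.

(* Omega_{2n}: image of H^{n x n} under the standard complex representation *)
Definition in_Omega (n : nat) (A : 'M[C]_(n + n)) : Prop :=
  exists A1 A2 : 'M[C]_n, A = block_mx A1 (cconj_mx A2) (- A2) (cconj_mx A1).

Definition is_hermitian_mx (N : nat) (H : 'M[C]_N) : Prop := adj_mx H = H.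

Definition H_selfadjoint (N : nat) (H A : 'M[C]_N) : Prop := H *m A = adj_mx A *m H.

Definition jordan_entry (lam : C) (i j : nat) : C :=
  if i == j then lam else if j == i.+1 then 1 else 0.
Definition antidiag_entry (k : nat) (s : C) (i j : nat) : C :=
  if i + j == k.-1 then s else 0.

(* block diagonal matrix built from a list of (size, entry function) blocks;
   meaningful when the sizes sum to N *)
Fixpoint bd_entry (s : seq (nat * (nat -> nat -> C))) (i j : nat) : C :=
  match s with
  | [::] => 0
  | (k, f) :: s' =>
      if (i < k)%N && (j < k)%N then f i j
      else if (k <= i)%N && (k <= j)%N then bd_entry s' (i - k) (j - k)
      else 0
  end.
Definition bdiag (N : nat) (s : seq (nat * (nat -> nat -> C))) : 'M[C]_N :=
  \matrix_(i < N, j < N) bd_entry s i j.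

(* Blocks of the canonical form:
   inl (k, lam, eta) : real eigenvalue lam, J_k(lam) in both M and M', eta Q_k in N
                       (eta = true means +1, false means -1);
   inr (k, a, b)     : nonreal eigenvalue lam = a + i b with b > 0,
                       J_k(lam) (+) J_k(conj lam) in M, J_k(conj lam) (+) J_k(lam) in M',
                       Q_{2k} in N. *)
Definition cblock := ((nat * R * bool) + (nat * R * R))%type.

Definition sgn (e : bool) : C := if e then 1 else -1.

Definition cb_valid (b : cblock) : bool :=
  match b with
  | inl (k, _, _) => (0 < k)%N
  | inr (k, _, y) => (0 < k)%N && (0 < y)
  end.

Definition cb_size (b : cblock) : nat :=
  match b with inl (k, _, _) => k | inr (k, _, _) => k.*2 end.

Definition cb_M (b : cblock) : seq (nat * (nat -> nat -> C)) :=
  match b with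
  | inl (k, l, _) => [:: (k, jordan_entry (l%:C))]
  | inr (k, x, y) => [:: (k, jordan_entry (x +i* y)); (k, jordan_entry (x -i* y))]
  end%C.
Definition cb_M' (b : cblock) : seq (nat * (nat -> nat -> C)) :=
  match b with
  | inl (k, l, _) => [:: (k, jordan_entry (l%:C))]
  | inr (k, x, y) => [:: (k, jordan_entry (x -i* y)); (k, jordan_entry (x +i* y))]
  end%C.
Definition cb_N (b : cblock) : seq (nat * (nat -> nat -> C)) :=
  match b with
  | inl (k, _, e) => [:: (k, antidiag_entry k (sgn e))]
  | inr (k, _, _) => [:: (k.*2, antidiag_entry k.*2 1)]
  end.

Definition cf_M (cf : seq cblock) := flatten (map cb_M cf).
Definition cf_M' (cf : seq cblock) := flatten (map cb_M' cf).
Definition cf_N (cf : seq cblock) := flatten (map cb_N cf).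

Definition canonical_reduction (n : nat) (B H S : 'M[C]_(n + n)) (cf : seq cblock) : Prop :=
  [/\ in_Omega S, S \in unitmx, all cb_valid cf, sumn (map cb_size cf) = n &
    (invmx S *m B *m S = block_mx (bdiag n (cf_M cf)) 0 0 (bdiag n (cf_M' cf))
     /\ adj_mx S *m H *m S = block_mx (bdiag n (cf_N cf)) 0 0 (bdiag n (cf_N cf)))].

(* real blocks with negative / zero eigenvalue (these, in both copies, form the
   part of the canonical form corresponding to negative / zero eigenvalues) *)
Definition neg_part (cf : seq cblock) : seq cblock :=
  [seq b <- cf | if b is inl (_, l, _) then l < 0 else false].
Definition zero_part (cf : seq cblock) : seq cblock :=
  [seq b <- cf | if b is inl (_, l, _) then l == 0 else false].

Definition cond_neg (cf : seq cblock) : Prop :=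
  exists ts : seq (nat * R),
    all (fun t => (0 < t.1)%N && (t.2 < 0)) ts /\
    perm_eq (neg_part cf)
      (flatten [seq [:: inl (t.1, t.2, true); inl (t.1, t.2, false)] | t <- ts]).

Definition zero_group (a r : nat) (eps : seq bool) : seq cblock :=
  [seq inl (a.+1, 0, e) | e <- take r eps] ++
  (if (0 < a)%N then [seq inl (a, 0, e) | e <- drop r eps] else [::]).

Definition balanced (eta : bool) (s : seq bool) : bool :=
  if odd (size s) then count (pred1 eta) s == (count (pred1 (~~ eta)) s).+1
  else count (pred1 eta) s == count (pred1 (~~ eta)) s.

Definition cond_zero (m : nat) (cf : seq cblock) : Prop :=
  exists gs : seq (nat * nat * seq bool),
    all (fun g => let: (a, r, eps) := g in
           [&& (0 < r)%N, (r <= m)%N, size eps == m &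
               [exists eta : bool, balanced eta (take r eps) && balanced eta (drop r eps)]]) gs /\
    perm_eq (zero_part cf)
      (flatten [seq let: (a, r, eps) := g in zero_group a r eps | g <- gs]).

End QuatDefs.

(* Main.v *)
Require Import Defs.
From HB Require Import structures.
From mathcomp Require Import all_boot all_order all_algebra.
From mathcomp Require Import reals complex.
From mathcomp Require Import zify ring.
Set Implicit Arguments. Unset Strict Implicit. Unset Printing Implicit Defensive.
Import Order.TTheory GRing.Theory Num.Theory.
Local Open Scope ring_scope.

(** A matrix in Omega_{2n} commutes with the antilinear map v |-> J conj(v), so a canonical
    reduction amounts to n complex columns W, the other n being J conj(W), that span a
    B-invariant space, have the prescribed Gram matrix for H, and are H-orthogonal to
    J conj(W).  Such frames are built one Jordan chain at a time inside the H-orthogonal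
    complement of what is already found; the skew-symmetry of the bilinear form
    (x, y) |-> x^* H J conj(y) makes every chain orthogonal to its own quaternionic conjugate.
    This yields the canonical form of a root A, and the canonical form of A^m is then computed
    block by block with complex matrices only: a nonzero real block stays a block, a nonreal
    pair whose m-th power is real becomes a pair of opposite signs, and J_N(0)^m splits along
    the residue classes modulo m, which the anti-diagonal form pairs off by c + c' = N - 1.
    Conversely the two conditions say exactly that the block list of B arises in this way from
    the blocks of some A, up to permutation. *)

Local Arguments conjc : simpl never.

(** * Entrywise conjugation and the adjoint *)

Section Adjoint.
Variable R : realType.
Local Notation C := (R[i]).

(** The quaternionic structure enters a frame W only through W^* K conj(W) = 0. This survives every
    complex change of columns W T, because W^* K conj(W) sits in the middle of the new product.
    Hence any T that reduces a pair (M^m, N) of complex block matrices lifts back to frames, and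
    powers can be studied over C alone.

    The shape of the two conditions has the following origin. A negative number has no real m-th
    root for even m, so its blocks must come from chains at z and conj(z) paired with each other;
    once z^m is real both chains share one eigenvalue, the form is hyperbolic, and it diagonalizes
    to Q and -Q. For J_N(0) with N = a m + r, 0 < r <= m, a residue class c < r carries a chain of
    length a + 1, any other class one of length a. Index reversal sends c to r - 1 - c below r, and
    to m + r - 1 - c from r on. Two exchanged classes give both signs once; a fixed class gives the
    sign of the original block. Each range has a fixed class exactly when its number of classes is
    odd: this is the balance rule, with one eta_j for both ranges. *)

Lemma cconjM p q r (A : 'M[C]_(p, q)) (B : 'M_(q, r)) :
  cconj_mx (A *m B) = cconj_mx A *m cconj_mx B.
Proof. exact: map_mxM. Qed.
Lemma cconjD p q (A B : 'M[C]_(p, q)) : cconj_mx (A + B) = cconj_mx A + cconj_mx B.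
Proof. exact: raddfD. Qed.
Lemma cconjN p q (A : 'M[C]_(p, q)) : cconj_mx (- A) = - cconj_mx A.
Proof. exact: raddfN. Qed.
Lemma cconj0 p q : cconj_mx (0 : 'M[C]_(p, q)) = 0.
Proof. exact: raddf0. Qed.
Lemma cconj1 p : cconj_mx (1%:M : 'M[C]_p) = 1%:M.
Proof. exact: map_mx1. Qed.
Lemma cconjZ p q a (A : 'M[C]_(p, q)) : cconj_mx (a *: A) = (a^*)%C *: cconj_mx A.
Proof. exact: map_mxZ. Qed.
Lemma cconjK p q (A : 'M[C]_(p, q)) : cconj_mx (cconj_mx A) = A.
Proof. by apply/matrixP => i j; rewrite !mxE conjcK. Qed.
Lemma cconjT p q (A : 'M[C]_(p, q)) : cconj_mx A^T = (cconj_mx A)^T.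
Proof. by rewrite /cconj_mx map_trmx. Qed.

Lemma cconjX p (A : 'M[C]_p) m : cconj_mx (A ^+ m) = cconj_mx A ^+ m.
Proof.
elim: m => [|m IH]; first by rewrite !expr0 -idmxE cconj1.
by rewrite !exprS -!mulmxE cconjM IH.
Qed.

Lemma adjmxM p q r (A : 'M[C]_(p, q)) (B : 'M_(q, r)) :
  adj_mx (A *m B) = adj_mx B *m adj_mx A.
Proof. by rewrite /adj_mx cconjM trmx_mul. Qed.
Lemma adjmxD p q (A B : 'M[C]_(p, q)) : adj_mx (A + B) = adj_mx A + adj_mx B.
Proof. by rewrite /adj_mx cconjD raddfD. Qed.
Lemma adjmxN p q (A : 'M[C]_(p, q)) : adj_mx (- A) = - adj_mx A.
Proof. by rewrite /adj_mx cconjN raddfN. Qed.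
Lemma adjmxB p q (A B : 'M[C]_(p, q)) : adj_mx (A - B) = adj_mx A - adj_mx B.
Proof. by rewrite adjmxD adjmxN. Qed.
Lemma adjmx0 p q : adj_mx (0 : 'M[C]_(p, q)) = 0.
Proof. by rewrite /adj_mx cconj0 trmx0. Qed.
Lemma adjmx1 p : adj_mx (1%:M : 'M[C]_p) = 1%:M.
Proof. by rewrite /adj_mx cconj1 trmx1. Qed.
Lemma adjmxZ p q a (A : 'M[C]_(p, q)) : adj_mx (a *: A) = (a^*)%C *: adj_mx A.
Proof. by rewrite /adj_mx cconjZ linearZ. Qed.
Lemma adjmxK p q (A : 'M[C]_(p, q)) : adj_mx (adj_mx A) = A.
Proof. by rewrite /adj_mx cconjT cconjK trmxK. Qed.
Lemma adj_scalar p (a : C) : adj_mx (a%:M : 'M[C]_p) = ((a^*)%C)%:M.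
Proof. by rewrite -scalemx1 adjmxZ adjmx1 scalemx1. Qed.
Lemma adj_row p q r (A : 'M[C]_(p, q)) (B : 'M_(p, r)) :
  adj_mx (row_mx A B) = col_mx (adj_mx A) (adj_mx B).
Proof. by rewrite /adj_mx /cconj_mx map_row_mx tr_row_mx. Qed.
Lemma adj_col p q r (A : 'M[C]_(q, p)) (B : 'M_(r, p)) :
  adj_mx (col_mx A B) = row_mx (adj_mx A) (adj_mx B).
Proof. by rewrite /adj_mx /cconj_mx map_col_mx tr_col_mx. Qed.
Lemma adj_block p q r s (A : 'M[C]_(p, q)) B D (E : 'M_(r, s)) :
  adj_mx (block_mx A B D E) = block_mx (adj_mx A) (adj_mx D) (adj_mx B) (adj_mx E).
Proof. by rewrite /adj_mx /cconj_mx map_block_mx tr_block_mx. Qed.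
Lemma cconj_row p q r (A : 'M[C]_(p, q)) (B : 'M_(p, r)) :
  cconj_mx (row_mx A B) = row_mx (cconj_mx A) (cconj_mx B).
Proof. exact: map_row_mx. Qed.
Lemma cconj_col p q r (A : 'M[C]_(q, p)) (B : 'M_(r, p)) :
  cconj_mx (col_mx A B) = col_mx (cconj_mx A) (cconj_mx B).
Proof. exact: map_col_mx. Qed.
Lemma cconj_block p q r s (A : 'M[C]_(p, q)) B D (E : 'M_(r, s)) :
  cconj_mx (block_mx A B D E) =
  block_mx (cconj_mx A) (cconj_mx B) (cconj_mx D) (cconj_mx E).
Proof. exact: map_block_mx. Qed.
Lemma adj_cconj p q (A : 'M[C]_(p, q)) : adj_mx (cconj_mx A) = A^T.
Proof. by rewrite /adj_mx cconjK. Qed.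
Lemma tr_adj_mx p q (A : 'M[C]_(p, q)) : (adj_mx A)^T = cconj_mx A.
Proof. by rewrite /adj_mx trmxK. Qed.

End Adjoint.

(** * Block diagonal matrices *)

Section BlockDiag.
Variable R : realType.
Local Notation C := (R[i]).
Implicit Types (s : seq (nat * (nat -> nat -> C))) (cf : seq (cblock R)).

Lemma bd_entry_cat s1 s2 i j (k := sumn (unzip1 s1)) :
  bd_entry (s1 ++ s2) i j =
  if (i < k)%N && (j < k)%N then bd_entry s1 i j
  else if (k <= i)%N && (k <= j)%N then bd_entry s2 (i - k) (j - k) else 0.
Proof.
rewrite {}/k; elim: s1 i j => [|[k f] s1 IH] i j /=; first by rewrite !subn0.
rewrite IH !subnDA; set K := sumn _.
do ![case: ifPn => ?] => //; lia.
Qed.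

Lemma bdiag_cat k1 k2 s1 s2 : sumn (unzip1 s1) = k1 ->
  bdiag (k1 + k2) (s1 ++ s2) = block_mx (bdiag k1 s1) 0 0 (bdiag k2 s2).
Proof.
move=> <-; apply/matrixP => i j; rewrite mxE bd_entry_cat.
case: (split_ordP i) => i' ->; case: (split_ordP j) => j' ->.
- rewrite block_mxEul mxE; have := ltn_ord i'; have := ltn_ord j'.
  by do ![case: ifPn] => //=; lia.
- rewrite block_mxEur mxE; have := ltn_ord i'; have := ltn_ord j'.
  by do ![case: ifPn] => //=; lia.
- rewrite block_mxEdl mxE; have := ltn_ord i'; have := ltn_ord j'.
  by do ![case: ifPn] => //=; lia.
- rewrite block_mxEdr mxE /= !addKn; have := ltn_ord i'; have := ltn_ord j'.
  by do ![case: ifPn] => //=; lia.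
Qed.

Lemma cf_M_size cf : sumn (unzip1 (cf_M cf)) = sumn (map (@cb_size R) cf).
Proof.
elim: cf => //= b cf IH; rewrite /cf_M /= /unzip1 map_cat sumn_cat -/(unzip1 _) IH.
by case: b => [[[k l] e]|[[k x] y]] /=; lia.
Qed.

Lemma cf_N_size cf : sumn (unzip1 (cf_N cf)) = sumn (map (@cb_size R) cf).
Proof.
elim: cf => //= b cf IH; rewrite /cf_N /= /unzip1 map_cat sumn_cat -/(unzip1 _) IH.
by case: b => [[[k l] e]|[[k x] y]] /=; lia.
Qed.

Lemma cf_M_cat cf1 cf2 : cf_M (cf1 ++ cf2) = cf_M cf1 ++ cf_M cf2.
Proof. by rewrite /cf_M map_cat flatten_cat. Qed.
Lemma cf_N_cat cf1 cf2 : cf_N (cf1 ++ cf2) = cf_N cf1 ++ cf_N cf2.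
Proof. by rewrite /cf_N map_cat flatten_cat. Qed.

Definition cfMmx k cf := bdiag k (cf_M cf).
Definition cfNmx k cf := bdiag k (cf_N cf).

Lemma cfMmx_cat k1 k2 cf1 cf2 : sumn (map (@cb_size R) cf1) = k1 ->
  cfMmx (k1 + k2) (cf1 ++ cf2) = block_mx (cfMmx k1 cf1) 0 0 (cfMmx k2 cf2).
Proof. by move=> h; rewrite /cfMmx cf_M_cat bdiag_cat // cf_M_size. Qed.
Lemma cfNmx_cat k1 k2 cf1 cf2 : sumn (map (@cb_size R) cf1) = k1 ->
  cfNmx (k1 + k2) (cf1 ++ cf2) = block_mx (cfNmx k1 cf1) 0 0 (cfNmx k2 cf2).
Proof. by move=> h; rewrite /cfNmx cf_N_cat bdiag_cat // cf_N_size. Qed.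

(** Conjugation fixes a real block and exchanges the two halves of a nonreal pair, which is the only
    difference between M and M'. The second half of a canonical form is thus determined by the
    first. *)
Lemma bdiag_conj k cf : bdiag k (cf_M' cf) = cconj_mx (cfMmx k cf).
Proof.
apply/matrixP => i j; rewrite !mxE.
have conjJ l (u v : nat) : ((jordan_entry l u v)^*)%C = jordan_entry ((l^*)%C) u v.
  by rewrite /jordan_entry; do 2?case: ifP => _ //; rewrite ?conjc1 ?conjc0.
elim: cf (i : nat) (j : nat) => [|b cf IH] u v /=; first by rewrite conjc0.
rewrite /cf_M /cf_M' /=.
case: b => [[[k' l] e]|[[k' x] y]] /=; rewrite -!/(cf_M cf) -!/(cf_M' cf);
  rewrite !IH; do ![case: ifP => _]; rewrite ?conjJ ?conjc0 ?conjc_real //.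
by rewrite /conjc opprK.
Qed.

Lemma antidiagE k (a : C) i j :
  antidiag_entry k a i j = if (i + j == k.-1)%N then a else 0.
Proof. by []. Qed.

Lemma cfNmx_adj k cf : adj_mx (cfNmx k cf) = cfNmx k cf.
Proof.
apply/matrixP => i j; rewrite !mxE.
elim: cf (i : nat) (j : nat) => [|b cf IH] u v /=; first by rewrite conjc0.
have conjA l (x y : nat) (a : C) : ((a)^*)%C = a ->
    ((antidiag_entry l a x y)^*)%C = antidiag_entry l a y x.
  by move=> ha; rewrite !antidiagE addnC; case: ifP => _; rewrite ?conjc0.
rewrite /cf_N /=.
case: b => [[[k' l] e]|[[k' x] y]] /=; rewrite -!/(cf_N cf);
  rewrite -(IH (u - _)%N) [(v < _)%N && _]andbC [(_ <= v)%N && _]andbC;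
  case: ifP => _; rewrite ?conjA ?rmorph1 //; try by [case: ifP => _; rewrite ?conjc0].
by case: (e); rewrite /sgn ?rmorphN rmorph1.
Qed.

Lemma cfNmx_cconj k cf : cconj_mx (cfNmx k cf) = cfNmx k cf.
Proof.
apply/matrixP => i j; rewrite !mxE.
elim: cf (i : nat) (j : nat) => [|b cf IH] u v /=; first by rewrite conjc0.
have conjA l (x y : nat) (a : C) : ((a)^*)%C = a ->
    ((antidiag_entry l a x y)^*)%C = antidiag_entry l a x y.
  by move=> ha; rewrite !antidiagE; case: ifP => _; rewrite ?conjc0.
rewrite /cf_N /=.
case: b => [[[l c] e]|[[l x] y]] /=; rewrite -!/(cf_N cf).
  case: ifP => _; last by case: ifP => _; [exact: IH|exact: conjc0].
  by apply: conjA; case: (e); rewrite /sgn ?rmorphN rmorph1.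
case: ifP => _; last by case: ifP => _; [exact: IH|exact: conjc0].
exact/conjA/rmorph1.
Qed.

End BlockDiag.

Section Blocks.
Variable R : realType.
Local Notation C := (R[i]).
Implicit Types (cf : seq (cblock R)).

Definition Jm k (a : C) : 'M[C]_k := \matrix_(i, j) jordan_entry a i j.
Definition Qm k (a : C) : 'M[C]_k := \matrix_(i, j) antidiag_entry k a i j.

Lemma bdiag1 k f : bdiag k [:: (k, f)] = \matrix_(i < k, j < k) f i j :> 'M[C]_k.
Proof. by apply/matrixP => i j; rewrite !mxE /= !ltn_ord. Qed.

Lemma cfMmx_inl k l e : cfMmx k [:: inl (k, l, e)] = Jm k l%:C%C.
Proof. exact: bdiag1. Qed.
Lemma cfNmx_inl k l e : cfNmx k [:: inl (k, l, e)] = Qm k (sgn R e).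
Proof. exact: bdiag1. Qed.
Lemma cfMmx_inr k (x y : R) :
  cfMmx (k + k) [:: inr (k, x, y)] = block_mx (Jm k (x +i* y)%C) 0 0 (Jm k (x -i* y)%C).
Proof.
rewrite /cfMmx /cf_M /= -cat1s bdiag_cat /=; last by rewrite addn0.
by rewrite !bdiag1.
Qed.
(** Cutting Q_{2k} into quarters shows the form as a hyperbolic pairing: each of the two chains is
    isotropic and they are dual to each other. *)
Lemma cfNmx_inr k (x y : R) :
  cfNmx (k + k) [:: inr (k, x, y)] = block_mx 0 (Qm k 1) (Qm k 1) 0.
Proof.
rewrite /cfNmx /cf_N /= -addnn bdiag1.
apply/matrixP => i j; rewrite mxE antidiagE.
case: (split_ordP i) => i' ->; case: (split_ordP j) => j' ->;
  rewrite ?block_mxEul ?block_mxEur ?block_mxEdl ?block_mxEdr !mxE ?antidiagE;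
  have := ltn_ord i'; have := ltn_ord j'; do ![case: ifPn] => //=; lia.
Qed.

Lemma Qm_sq k (a : C) : a * a = 1 -> Qm k a *m Qm k a = 1%:M.
Proof.
move=> ha; apply/matrixP => i j; rewrite !mxE (bigD1 (rev_ord i)) //= big1 => [|l hl].
  rewrite !mxE !antidiagE /= addr0.
  have := ltn_ord i; have := ltn_ord j; rewrite -val_eqE /= => hj hi.
  case: ifPn => h1; last by lia.
  by case: ifPn => h2; case: eqP => h3 //=; rewrite ?ha ?mulr0 //; lia.
rewrite !mxE !antidiagE; case: ifPn => h1; last by rewrite mul0r.
move: hl; rewrite -val_eqE /=; have := ltn_ord i; lia.
Qed.

(** Each antidiagonal block is a reversal times a sign, hence an involution. Gram matrices of frames
    therefore have an explicit inverse, which yields left inverses and projections by formula. *)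
Lemma cfNmx_sq k cf : sumn (map (@cb_size R) cf) = k -> cfNmx k cf *m cfNmx k cf = 1%:M.
Proof.
elim: cf k => [|b cf IH] k /= <-; first by rewrite [LHS]flatmx0 [RHS]flatmx0.
rewrite -cat1s cfNmx_cat /= ?addn0 // mulmx_block !mulmx0 !mul0mx !addr0 !add0r IH //.
suff -> : cfNmx (cb_size b) [:: b] *m cfNmx (cb_size b) [:: b] = 1%:M by rewrite -scalar_mx_block.
case: b => [[[k' l] e]|[[k' x] y]] /=; rewrite /cfNmx /cf_N /= bdiag1; apply: Qm_sq.
  by case: e; rewrite /sgn ?mulrNN mulr1.
by rewrite mulr1.
Qed.
End Blocks.

(** * Frames *)

Section Frames.
Variable R : realType.
Local Notation C := (R[i]).
Implicit Types (cf : seq (cblock R)).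
Variables (p : nat) (M H K : 'M[C]_p).

(* The form [K] is [H *m Jq] for quaternionic frames, and [0] for a plain complex pair [(M, H)]. *)
Definition frame k (W : 'M[C]_(p, k)) cf : Prop :=
  [/\ sumn (map (@cb_size R) cf) = k, M *m W = W *m cfMmx k cf,
      adj_mx W *m H *m W = cfNmx k cf & adj_mx W *m K *m cconj_mx W = 0].

Hypothesis hH : adj_mx H = H.
Hypothesis hK : K^T = - K.

Lemma adj_sandwich k1 k2 (U : 'M_(p, k1)) (W : 'M_(p, k2)) :
  adj_mx (adj_mx U *m H *m W) = adj_mx W *m H *m U.
Proof. by rewrite !adjmxM adjmxK hH mulmxA. Qed.

Lemma tr_sandwich k1 k2 (U : 'M_(p, k1)) (W : 'M_(p, k2)) :
  (adj_mx U *m K *m cconj_mx W)^T = - (adj_mx W *m K *m cconj_mx U).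
Proof. by rewrite !trmx_mul hK tr_adj_mx -/(adj_mx W) mulNmx mulmxN mulmxA. Qed.

Lemma frame_cat k1 k2 (W1 : 'M_(p, k1)) (W2 : 'M_(p, k2)) cf1 cf2 :
  frame W1 cf1 -> frame W2 cf2 ->
  adj_mx W1 *m H *m W2 = 0 -> adj_mx W1 *m K *m cconj_mx W2 = 0 ->
  frame (row_mx W1 W2) (cf1 ++ cf2).
Proof.
move=> [s1 a1 b1 c1] [s2 a2 b2 c2] h12 k12; split.
- by rewrite map_cat sumn_cat s1 s2.
- rewrite mul_mx_row a1 a2 cfMmx_cat // mul_row_block !mulmx0.
  by rewrite addr0 add0r.
- rewrite adj_row mul_col_mx mul_col_row b1 b2 h12 cfNmx_cat //.
  by rewrite -[adj_mx W2 *m H *m W1]adj_sandwich h12 adjmx0.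
- rewrite adj_row mul_col_mx cconj_row mul_col_row c1 c2 k12.
  rewrite -[adj_mx W2 *m K *m _]opprK -tr_sandwich k12 trmx0 oppr0.
  by rewrite block_mx0.
Qed.

Lemma frame_row_inv k1 k2 (W1 : 'M_(p, k1)) (W2 : 'M_(p, k2)) cf1 cf2 :
  sumn (map (@cb_size R) cf1) = k1 -> frame (row_mx W1 W2) (cf1 ++ cf2) ->
  [/\ frame W1 cf1, frame W2 cf2, adj_mx W1 *m H *m W2 = 0 &
      adj_mx W1 *m K *m cconj_mx W2 = 0].
Proof.
move=> hk1; case; rewrite map_cat sumn_cat hk1 => /addnI hk2.
rewrite cfMmx_cat // cfNmx_cat // mul_row_block !mulmx0 mul_mx_row addr0 add0r.
move/eq_row_mx => [a1 a2].
rewrite adj_row mul_col_mx mul_col_row => /eq_block_mx [b1 b12 b21 b2].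
rewrite mul_col_mx cconj_row mul_col_row -block_mx0 => /eq_block_mx [c1 c12 c21 c2].
by split.
Qed.

(** A permutation of blocks is a permutation of groups of columns, and it suffices to exchange two
    adjacent segments. *)
Lemma frame_perm cf cf' : perm_eq cf cf' ->
  (exists k (W : 'M_(p, k)), frame W cf) -> exists k (W : 'M_(p, k)), frame W cf'.
Proof.
move: cf cf'; apply: (@catCA_perm_ind _ (fun cf => exists k (W : 'M_(p, k)), frame W cf)).
move=> s1 s2 s3 [k [W fW]].
have hk : k = (sumn (map (@cb_size R) s1) + (sumn (map (@cb_size R) s2) +
   sumn (map (@cb_size R) s3)))%N by case: fW; rewrite !map_cat !sumn_cat.
subst k; move: fW; rewrite -[W]hsubmxK -[rsubmx W]hsubmxK.
move: (lsubmx W) (lsubmx (rsubmx W)) (rsubmx (rsubmx W)) => W1 W2 W3.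
case/frame_row_inv => // f1 /frame_row_inv [] // f2 f3 h23 c23.
rewrite cconj_row !mul_mx_row -row_mx0 => /eq_row_mx [h12 h13].
move=> /eq_row_mx [c12 c13].
exists _, (row_mx W2 (row_mx W1 W3)).
have h21 : adj_mx W2 *m H *m W1 = 0 by rewrite -adj_sandwich h12 adjmx0.
have c21 : adj_mx W2 *m K *m cconj_mx W1 = 0.
  by rewrite -[LHS]opprK -tr_sandwich c12 trmx0 oppr0.
apply: frame_cat => //; first exact: frame_cat.
  by rewrite mul_mx_row h21 h23 row_mx0.
by rewrite cconj_row mul_mx_row c21 c23 row_mx0.
Qed.

Lemma frame_inj k (W : 'M_(p, k)) cf : frame W cf ->
  cfNmx k cf *m adj_mx W *m H *m W = 1%:M.
Proof. by case=> hs _ hN _; rewrite -!mulmxA mulmxA -mulmxA (mulmxA (adj_mx W)) hN cfNmx_sq. Qed.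

Lemma frame0 : frame (0 : 'M_(p, 0)) [::].
Proof. by split=> //; rewrite ?thinmx0 // [LHS]flatmx0 [RHS]flatmx0. Qed.
End Frames.

(** * Jordan chains *)

Lemma mulmx_col (T : pzRingType) a b c (A : 'M[T]_(a, b)) (B : 'M_(b, c)) j :
  A *m col j B = col j (A *m B).
Proof. by rewrite !colE mulmxA. Qed.

Section Chains.
Variable R : realType.
Local Notation C := (R[i]).
Implicit Types (cf : seq (cblock R)).
Variables (p : nat) (M H K : 'M[C]_p).
Hypothesis hH : adj_mx H = H.
Hypothesis hK : K^T = - K.
Hypothesis hM : H *m M = adj_mx M *m H.
Hypothesis hMK : adj_mx M *m K = K *m cconj_mx M.

Definition ip (x y : 'cV[C]_p) : C := (adj_mx x *m H *m y) 0 0.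
(** Conjugate-linear in both arguments. A shift by [a] therefore passes across with the same [a],
    whereas across [ip] it becomes the shift by the conjugate. *)
Definition bp (x y : 'cV[C]_p) : C := (adj_mx x *m K *m cconj_mx y) 0 0.
Definition shift_mx (a : C) : 'M[C]_p := M - a%:M.

Lemma ipDl x y z : ip (x + y) z = ip x z + ip y z.
Proof. by rewrite /ip adjmxD !mulmxDl mxE. Qed.
Lemma ipDr x y z : ip z (x + y) = ip z x + ip z y.
Proof. by rewrite /ip !mulmxDr mxE. Qed.
Lemma ipZl a x z : ip (a *: x) z = (a^*)%C * ip x z.
Proof. by rewrite /ip adjmxZ -!scalemxAl mxE. Qed.
Lemma ipZr a x z : ip z (a *: x) = a * ip z x.
Proof. by rewrite /ip -!scalemxAr mxE. Qed.
Lemma ip0r z : ip z 0 = 0.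
Proof. by rewrite /ip mulmx0 mxE. Qed.
Lemma ip0l z : ip 0 z = 0.
Proof. by rewrite /ip adjmx0 !mul0mx mxE. Qed.
Lemma ipC x y : ip x y = ((ip y x)^*)%C.
Proof. by rewrite /ip -[adj_mx x *m H *m y]adj_sandwich // !mxE. Qed.
Lemma ipM x y : ip (M *m x) y = ip x (M *m y).
Proof. by rewrite /ip adjmxM -!mulmxA (mulmxA _ H) -hM !mulmxA. Qed.
Lemma ip_shift a x y : ip (shift_mx ((a^*)%C) *m x) y = ip x (shift_mx a *m y).
Proof.
rewrite /ip adjmxM -!mulmxA (mulmxA _ H) /shift_mx adjmxB adj_scalar conjcK mulmxBl -hM.
by rewrite -scalar_mxC -mulmxBr !mulmxA.
Qed.
Lemma ip_shiftX a i x y : ip (shift_mx ((a^*)%C) ^+ i *m x) y = ip x (shift_mx a ^+ i *m y).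
Proof.
elim: i x => [|i IH] x; first by rewrite !expr0 -idmxE !mul1mx.
by rewrite [in LHS]exprSr -mulmxE -mulmxA IH ip_shift mulmxA mulmxE -exprS.
Qed.

Lemma bpC x y : bp x y = - bp y x.
Proof. by rewrite /bp -[adj_mx x *m _ *m _]trmxK tr_sandwich // !mxE. Qed.
Lemma bp_shift a x y : bp (shift_mx a *m x) y = bp x (shift_mx a *m y).
Proof.
rewrite /bp /shift_mx adjmxM adjmxB adj_scalar cconjM cconjD cconjN.
rewrite /cconj_mx map_scalar_mx -!/(cconj_mx _) -!mulmxA; congr ((_ *m _) 0 0).
by rewrite !mulmxA mulmxBl mulmxBr hMK scalar_mxC.
Qed.
Lemma bp_shiftX a i x y : bp (shift_mx a ^+ i *m x) y = bp x (shift_mx a ^+ i *m y).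
Proof.
elim: i x => [|i IH] x; first by rewrite !expr0 -idmxE !mul1mx.
by rewrite [in LHS]exprSr -mulmxE -mulmxA IH bp_shift mulmxA mulmxE -exprS.
Qed.
(** Moving all powers to one side and back across the skew form gives b(x, N^s x) = - b(x, N^s x)
    with s = i + j. *)
Lemma bp_cyc a i j x : bp (shift_mx a ^+ i *m x) (shift_mx a ^+ j *m x) = 0.
Proof.
rewrite bp_shiftX mulmxA mulmxE -exprD.
have h : bp x (shift_mx a ^+ (i + j) *m x) = - bp x (shift_mx a ^+ (i + j) *m x).
  by rewrite {1}bpC bp_shiftX.
by apply/eqP; rewrite -eqNr -h.
Qed.

(** Powers decrease along the columns, so the eigenvector comes first, as an upper triangular Jordan
    block requires. *)
Definition chain k (N : 'M[C]_p) (x : 'cV[C]_p) : 'M[C]_(p, k) :=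
  \matrix_(i, j) (N ^+ (k.-1 - j) *m x) i 0.

Lemma chainE k N x i (j : 'I_k) : chain k N x i j = (N ^+ (k.-1 - j) *m x) i 0.
Proof. by rewrite mxE. Qed.

Lemma col_chain k N x (j : 'I_k) : col j (chain k N x) = N ^+ (k.-1 - j) *m x.
Proof. by apply/matrixP => i i'; rewrite !mxE ord1; apply: eq_bigr => l _. Qed.

Lemma gram_ip k1 k2 (U : 'M[C]_(p, k1)) (W : 'M_(p, k2)) i j :
  (adj_mx U *m H *m W) i j = ip (col i U) (col j W).
Proof.
have hU : adj_mx (col i U) = row i (adj_mx U) by apply/matrixP => a b; rewrite !mxE.
by rewrite /ip hU -!row_mul mulmx_col !mxE.
Qed.

Lemma gram_bp k1 k2 (U : 'M[C]_(p, k1)) (W : 'M_(p, k2)) i j :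
  (adj_mx U *m K *m cconj_mx W) i j = bp (col i U) (col j W).
Proof.
have hU : adj_mx (col i U) = row i (adj_mx U) by apply/matrixP => a b; rewrite !mxE.
have hW : cconj_mx (col j W) = col j (cconj_mx W) by apply/matrixP => a b; rewrite !mxE.
by rewrite /bp hU hW -!row_mul mulmx_col !mxE.
Qed.

Lemma chain_jordan k a x : shift_mx a ^+ k *m x = 0 ->
  M *m chain k (shift_mx a) x = chain k (shift_mx a) x *m Jm k a.
Proof.
move=> hx; apply/matrixP => i j.
have -> : (M *m chain k (shift_mx a) x) i j = (M *m (shift_mx a ^+ (k.-1 - j) *m x)) i 0.
  by rewrite -col_chain mulmx_col [RHS]mxE.
have hMx v : M *m v = shift_mx a *m v + a *: v :> 'cV_p.
  by rewrite mulmxBl mul_scalar_mx subrK.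
rewrite hMx mulmxA mulmxE -exprS mxE [X in _ + X]mxE.
rewrite [RHS]mxE (bigD1 j) //= chainE [Jm _ _ _ _]mxE /jordan_entry eqxx mulrC addrC.
congr (_ + _); have hj := ltn_ord j.
(* In column 0 the next power is N^k, which kills x; in any other column the superdiagonal 1 selects
   the preceding column. *)
case: (posnP (j : nat)) => [j0|jp].
  rewrite big1; last first.
    move=> l hl; rewrite [Jm _ _ _ _]mxE /jordan_entry j0.
    by move: hl; rewrite -val_eqE /= j0 => /negPf ->; rewrite mulr0.
  have -> : (k.-1 - j).+1 = k by lia.
  by rewrite hx mxE.
have hj' : (j.-1 < k)%N by lia.
rewrite (bigD1 (Ordinal hj')) /=; last by rewrite -val_eqE /=; lia.
rewrite big1 ?addr0; last first.
  move=> l /andP[hl]; rewrite -val_eqE /= => hl'; rewrite [Jm _ _ _ _]mxE /jordan_entry.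
  move: hl; rewrite -val_eqE /= => /negPf ->.
  by case: eqP => h; rewrite ?mulr0 //; lia.
rewrite chainE [Jm _ _ _ _]mxE /jordan_entry /=.
have -> : (j.-1 == j :> nat) = false by lia.
have -> : (j == j.-1.+1 :> nat) = true by lia.
by rewrite mulr1; have -> : (k.-1 - j).+1 = (k.-1 - j.-1)%N by lia.
Qed.

(** For real [l] the shift is selfadjoint, so a Gram entry depends only on the sum of the two
    powers. The whole Gram matrix is governed by k numbers, powers from k on being zero. *)
Lemma real_frame k (l : R) e x (N := shift_mx l%:C%C) : N ^+ k *m x = 0 ->
  (forall i, (i < k)%N -> ip x (N ^+ i *m x) = if i == k.-1 then sgn R e else 0) ->
  frame M H K (chain k N x) [:: inl (k, l, e)].
Proof.
move=> hx hi; split; rewrite ?cfMmx_inl ?cfNmx_inl /= ?addn0 //; first exact: chain_jordan.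
  apply/matrixP => i j; rewrite gram_ip !col_chain mxE antidiagE.
  have := ltn_ord i; have := ltn_ord j => hj hi'.
  rewrite /N -{1}[l%:C%C]conjc_real ip_shiftX mulmxA mulmxE -exprD -/N.
  case: (ltnP (k.-1 - i + (k.-1 - j))%N k) => h.
    by rewrite hi //; do 2?case: eqP => //; lia.
  rewrite -(subnK h) exprD -mulmxE -mulmxA hx mulmx0 ip0r.
  by case: eqP => //; lia.
by apply/matrixP => i j; rewrite gram_bp !col_chain bp_cyc mxE.
Qed.

(** The two shifts are adjoint to each other, so the cross Gram block is again governed by k
    numbers. Isotropy is a hypothesis because it has different sources: a nonreal eigenvalue,
    coordinate halves, or residue classes; in the last case [a] is 0. *)
Lemma pair_frame k (a : C) x z (N := shift_mx a) (N' := shift_mx ((a^*)%C)) :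
  N ^+ k *m x = 0 -> N' ^+ k *m z = 0 ->
  (forall i, (i < k)%N -> ip z (N ^+ i *m x) = if i == k.-1 then 1 else 0) ->
  (forall i j, ip (N ^+ i *m x) (N ^+ j *m x) = 0) ->
  (forall i j, ip (N' ^+ i *m z) (N' ^+ j *m z) = 0) ->
  (forall i j, bp (N ^+ i *m x) (N' ^+ j *m z) = 0) ->
  frame M H K (row_mx (chain k N x) (chain k N' z)) [:: inr (k, complex.Re a, complex.Im a)].
Proof.
move=> hx hz hzx hxx hzz hb.
have hzxQ : adj_mx (chain k N' z) *m H *m chain k N x = Qm k 1.
  apply/matrixP => i j; rewrite gram_ip !col_chain mxE antidiagE.
  have := ltn_ord i; have := ltn_ord j => hj hi'.
  rewrite /N' ip_shiftX mulmxA mulmxE -exprD -/N.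
  case: (ltnP (k.-1 - i + (k.-1 - j))%N k) => h.
    by rewrite hzx //; do 2?case: eqP => //; lia.
  rewrite -(subnK h) exprD -mulmxE -mulmxA hx mulmx0 ip0r.
  by case: eqP => //; lia.
have hxx0 : adj_mx (chain k N x) *m H *m chain k N x = 0.
  by apply/matrixP => i j; rewrite gram_ip !col_chain hxx mxE.
have hzz0 : adj_mx (chain k N' z) *m H *m chain k N' z = 0.
  by apply/matrixP => i j; rewrite gram_ip !col_chain hzz mxE.
have hbxz : adj_mx (chain k N x) *m K *m cconj_mx (chain k N' z) = 0.
  by apply/matrixP => i j; rewrite gram_bp !col_chain hb mxE.
split; first by rewrite /= addn0 addnn.
- have -> : cfMmx (k + k) [:: inr (k, complex.Re a, complex.Im a)] =
     block_mx (Jm k a) 0 0 (Jm k ((a^*)%C)) by rewrite cfMmx_inr; case: (a).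
  by rewrite mul_mx_row mul_row_block !mulmx0 addr0 add0r !chain_jordan.
- rewrite cfNmx_inr adj_row mul_col_mx mul_col_row hzxQ.
  rewrite -[adj_mx (chain k N x) *m H *m chain k N' z]adj_sandwich // hzxQ.
  have -> : adj_mx (Qm k 1) = Qm k 1 :> 'M[C]_k.
    by apply/matrixP => i j; rewrite !mxE !antidiagE addnC; case: ifP; rewrite ?conjc0 ?conjc1.
  by rewrite hxx0 hzz0.
- rewrite adj_row mul_col_mx cconj_row mul_col_row hbxz -block_mx0; congr block_mx.
  + by apply/matrixP => i j; rewrite gram_bp !col_chain bp_cyc mxE.
  + by rewrite -[LHS]opprK -tr_sandwich // hbxz trmx0 oppr0.
  + by apply/matrixP => i j; rewrite gram_bp !col_chain bp_cyc mxE.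
Qed.
End Chains.

(** * Normalization of Jordan chains *)

Section Normalization.
Variable R : realType.
Local Notation C := (R[i]).
Variables (p : nat) (M H : 'M[C]_p).
Hypothesis hH : adj_mx H = H.
Hypothesis hM : H *m M = adj_mx M *m H.
Local Notation ip := (ip H).
Local Notation shift_mx := (shift_mx M).
(** An M-stable subspace in which the normalization has to stay: the image of a projection, a
    coordinate half, or the whole space. *)
Variable P : 'cV[C]_p -> Prop.
Hypothesis PZD : forall a u v, P u -> P v -> P (a *: u + v).
Hypothesis PM : forall u, P u -> P (M *m u).

Lemma stableZ a u : P u -> P (a *: u).
Proof.
move=> Pu; have -> : a *: u = (a - 1) *: u + u by rewrite scalerBl scale1r subrK.
exact: PZD.
Qed.

Lemma shift_mx_stable a i u : P u -> P (shift_mx a ^+ i *m u).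
Proof.
move=> Pu; elim: i => [|i IH]; first by rewrite expr0 -idmxE mul1mx.
rewrite exprS -mulmxE -mulmxA mulmxBl mul_scalar_mx addrC -scaleNr.
exact/PZD/PM.
Qed.

(* The corrections [x + c N^s x], s = 1, 2, ..., fix the pairings one at a time from the top. *)
Lemma pair_normal k (a : C) x z (N := shift_mx a) : (0 < k)%N -> P x -> N ^+ k *m x = 0 ->
  ip z (N ^+ k.-1 *m x) != 0 ->
  exists x', [/\ P x', N ^+ k *m x' = 0 &
    forall i, (i < k)%N -> ip z (N ^+ i *m x') = if i == k.-1 then 1 else 0].
Proof.
move=> k0 Px hx hc.
suff : forall s, (s < k)%N -> exists x', [/\ P x', N ^+ k *m x' = 0 &
    forall i, (k.-1 - s <= i)%N -> ip z (N ^+ i *m x') = if i == k.-1 then 1 else 0].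
  move=> /(_ k.-1) []; first by lia.
  by move=> x' [h1 h2 h3]; exists x'; split=> // i hi; apply: h3; lia.
have hX i j (y : 'cV_p) : N ^+ i *m (N ^+ j *m y) = N ^+ (i + j) *m y.
  by rewrite mulmxA mulmxE -exprD.
have hbig i (y : 'cV_p) : N ^+ k *m y = 0 -> (k <= i)%N -> N ^+ i *m y = 0.
  by move=> hy hi; rewrite -(subnK hi) -hX hy mulmx0.
elim=> [|s IH] hs.
  exists ((ip z (N ^+ k.-1 *m x))^-1 *: x); split.
  - exact: stableZ.
  - by rewrite -scalemxAr hx scaler0.
  - move=> i hi; rewrite -scalemxAr ipZr; case: eqP => [->|h].
      by rewrite mulVf.
    by rewrite (hbig i _ hx) ?ip0r ?mulr0 //; lia.
have [x' [Px' hx' hi']] := IH (ltnW hs).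
(* At this index the correction meets the top pairing, already equal to 1, and contributes -c; at
   larger indices its exponent reaches k and it vanishes. *)
pose c := ip z (N ^+ (k.-1 - s.+1) *m x').
exists ((- c) *: (N ^+ s.+1 *m x') + x'); split.
- by apply: PZD => //; apply: shift_mx_stable.
- by rewrite mulmxDr -scalemxAr hX addnC -hX hx' mulmx0 scaler0 add0r.
- move=> i hi; rewrite mulmxDr -scalemxAr hX ipDr ipZr.
  case: (leqP (k.-1 - s) i) => hi2.
    by rewrite (hi' i) // (hbig (_ + _)%N _ hx') ?ip0r ?mulr0 ?add0r //; lia.
  have -> : i = (k.-1 - s.+1)%N by lia.
  rewrite -/c; have -> : (k.-1 - s.+1 + s.+1 = k.-1)%N by lia.
  rewrite hi' ?leq_subr // eqxx mulr1 addNr.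
  by case: eqP => //; lia.
Qed.

(** All pairings of x with N^i x are real, and rescaling x multiplies the top one by a positive
    number. Its sign is what remains, the eta of the block; the lower pairings are cleared as for a
    pair of chains. *)
Lemma real_normal k (l : R) x (N := shift_mx l%:C%C) : (0 < k)%N -> P x -> N ^+ k *m x = 0 ->
  ip x (N ^+ k.-1 *m x) != 0 ->
  exists x', [/\ P x', N ^+ k *m x' = 0 &
    forall i, (i < k)%N -> ip x' (N ^+ i *m x') =
       if i == k.-1 then sgn R (0 < ip x (N ^+ k.-1 *m x)) else 0].
Proof.
move=> k0 Px hx; set c0 := ip x _ => hc; set e := (0 < c0).
suff : forall s, (s < k)%N -> exists x', [/\ P x', N ^+ k *m x' = 0 &
    forall i, (k.-1 - s <= i)%N -> ip x' (N ^+ i *m x') = if i == k.-1 then sgn R e else 0].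
  move=> /(_ k.-1) []; first by lia.
  by move=> x' [h1 h2 h3]; exists x'; split=> // i hi; apply: h3; lia.
have hX i j (y : 'cV_p) : N ^+ i *m (N ^+ j *m y) = N ^+ (i + j) *m y.
  by rewrite mulmxA mulmxE -exprD.
have hbig i (y : 'cV_p) : N ^+ k *m y = 0 -> (k <= i)%N -> N ^+ i *m y = 0.
  by move=> hy hi; rewrite -(subnK hi) -hX hy mulmx0.
have hself i y u : ip (N ^+ i *m y) u = ip y (N ^+ i *m u).
  by rewrite /N -{1}[l%:C%C]conjc_real ip_shiftX.
have hreal i y : ((ip y (N ^+ i *m y))^*)%C = ip y (N ^+ i *m y).
  by rewrite -ipC // hself.
elim=> [|s IH] hs.
  have c0r : c0 \is Num.real by apply/CrealP; exact: hreal.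
  pose d := sqrtC `|c0|.
  have d0 : 0 < d by rewrite sqrtC_gt0 normr_gt0.
  have dr : ((d^-1)^*)%C = d^-1 by apply/CrealP; rewrite realV ger0_real ?ltW.
  exists (d^-1 *: x); split.
  - exact: stableZ.
  - by rewrite -scalemxAr hx scaler0.
  - move=> i hi; rewrite -scalemxAr ipZr ipZl dr; case: eqP => [->|h].
      rewrite mulrA -expr2 exprVn sqrtCK -/c0 /e /sgn; case: (real_ltgt0P c0r) => h.
      + by rewrite mulVf ?gt_eqF.
      + by rewrite invrN mulNr mulVf ?lt_eqF.
      + by rewrite h eqxx in hc.
    by rewrite (hbig i _ hx) ?ip0r ?mulr0 //; lia.
have [x' [Px' hx' hi']] := IH (ltnW hs).
pose b := ip x' (N ^+ (k.-1 - s.+1) *m x').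
have ee : sgn R e * sgn R e = 1 by case: (e); rewrite /sgn ?mulrNN mulr1.
(* The correction enters both arguments, hence the factor 1/2; the term quadratic in c has exponent
   at least k and drops out. The sign is its own inverse. *)
pose c := - (sgn R e * b / 2%:R).
have cr : ((c)^*)%C = c.
  apply/CrealP; rewrite realN realM ?realV ?realn // realM //.
    by rewrite /sgn; case: (e); rewrite ?realN ?real1.
  by apply/CrealP; exact: hreal.
exists (c *: (N ^+ s.+1 *m x') + x'); split.
- by apply: PZD => //; apply: shift_mx_stable.
- by rewrite mulmxDr -scalemxAr hX addnC -hX hx' mulmx0 scaler0 add0r.
- move=> i hi; rewrite mulmxDr -scalemxAr hX ipDr !ipDl !ipZl !ipZr cr !hself !hX.
  case: (leqP (k.-1 - s) i) => hi2.
    have h1 : N ^+ (i + s.+1) *m x' = 0 by apply: hbig => //; lia.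
    have h3 : N ^+ (s.+1 + (i + s.+1)) *m x' = 0 by apply: hbig => //; lia.
    by rewrite (addnC s.+1 i) h3 h1 !ip0r !mulr0 !add0r; exact: hi'.
  have -> : i = (k.-1 - s.+1)%N by lia.
  rewrite -/b; have -> : (s.+1 + (k.-1 - s.+1 + s.+1) = k.-1 + s.+1)%N by lia.
  have -> : (k.-1 - s.+1 + s.+1 = k.-1)%N by lia.
  have -> : (s.+1 + (k.-1 - s.+1) = k.-1)%N by lia.
  rewrite (hbig (_ + _)%N _ hx') ?ip0r ?mulr0 ?add0r; last by lia.
  rewrite hi' ?leq_subr // eqxx.
  have -> : (k.-1 - s.+1 == k.-1)%N = false by lia.
  by rewrite /c; case: (e) ee => _; rewrite /sgn; field.
Qed.
End Normalization.

(** * Existence of Jordan chains *)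

(** Inclusion of row spaces is reverse inclusion of kernels; some column of the cokernel matrix of B
    witnesses the failure. *)
Lemma nsubmx_witness (F : fieldType) a b c (A : 'M[F]_(a, c)) (B : 'M_(b, c)) :
  ~~ (A <= B)%MS -> exists u : 'cV_c, B *m u = 0 /\ A *m u != 0.
Proof.
rewrite submxE => hAB.
have [j hj] : exists j, A *m col j (cokermx B) != 0.
  apply/existsP; apply: contraNT hAB; rewrite negb_exists => /forallP h.
  apply/eqP/matrixP => i j; have := h j; rewrite negbK mulmx_col => /eqP/matrixP/(_ i 0).
  by rewrite !mxE.
exists (col j (cokermx B)); split=> //.
by rewrite mulmx_col mulmx_coker; apply/matrixP => i i'; rewrite !mxE.
Qed.

Lemma stable_eigenvector (F : closedFieldType) q (A P : 'M[F]_q) :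
  A *m P = P *m A -> P *m P = P -> P != 0 ->
  exists a (v : 'cV_q), [/\ v != 0, P *m v = v & A *m v = a *: v].
Proof.
(* The rows of X are a basis of the image of P, transposed because row spaces are the native
   subspaces; D is the matrix of A restricted to that image. *)
move=> hAP hPP hP; pose X := row_base P^T.
have /submxP[D hD] : (X *m A^T <= X)%MS.
  rewrite (eqmxMr _ (eq_row_base _)) eq_row_base -trmx_mul hAP trmx_mul.
  exact: submxMl.
have r0 : (0 < \rank P^T)%N by rewrite lt0n mxrank_eq0 trmx_eq0.
have [a] : exists a, root (char_poly D) a.
  by apply/closed_rootP; rewrite size_char_poly; case: (\rank _) r0.
rewrite -eigenvalue_root_char => /eigenvalueP[v hv v0].
have Xv0 : v *m X != 0 by rewrite mulmx_free_eq0 // row_base_free.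
exists a, (v *m X)^T; split.
- by rewrite trmx_eq0.
- have /submxP[Y hY] : (X <= P^T)%MS by rewrite eq_row_base.
  by apply: trmx_inj; rewrite trmx_mul trmxK -mulmxA hY -mulmxA -trmx_mul hPP.
- by apply: trmx_inj; rewrite trmx_mul trmxK -mulmxA hD mulmxA hv -scalemxAl linearZ /= trmxK.
Qed.

Section Isotropy.
Variable R : realType.
Local Notation C := (R[i]).
Variables (q : nat) (A H : 'M[C]_q).
Hypothesis hA : H *m A = adj_mx A *m H.
Local Notation ip := (ip H).
Local Notation shift_mx := (shift_mx A).

(** Induction on i + j: modulo shorter chains x and y are eigenvectors, so conj(a) [x, y] = [Ax, y]
    = [x, Ay] = a [x, y]. *)
Lemma nonreal_isotropic a i j x y : (a^*)%C != a ->
  shift_mx a ^+ i *m x = 0 -> shift_mx a ^+ j *m y = 0 -> ip x y = 0.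
Proof.
move=> ha; move: {2}(i + j)%N (leqnn (i + j)) => s; elim: s i j x y => [|s IH] i j x y hs.
  have -> : i = 0%N by lia.
  by rewrite expr0 -idmxE mul1mx => -> _; rewrite ip0l.
case: i hs => [|i] hs; first by rewrite expr0 -idmxE mul1mx => -> _; rewrite ip0l.
case: j hs => [|j] hs; first by rewrite expr0 -idmxE mul1mx => _ ->; rewrite ip0r.
move=> hx hy.
have nA z : A *m z = shift_mx a *m z + a *: z :> 'cV_q.
  by rewrite mulmxBl mul_scalar_mx subrK.
have h1 : ip (shift_mx a *m x) y = 0.
  by apply: (IH i j.+1) => //; rewrite mulmxA mulmxE -exprSr.
have h2 : ip x (shift_mx a *m y) = 0.
  by apply: (IH i.+1 j) => //; [lia|rewrite mulmxA mulmxE -exprSr].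
have := ipM hA x y; rewrite !nA ipDl ipDr h1 h2 !add0r ipZl ipZr => /eqP.
by rewrite -subr_eq0 -mulrBl mulf_eq0 subr_eq0 (negPf ha) /= => /eqP.
Qed.

Hypothesis hH : adj_mx H = H.

(** At a real eigenvalue one vector must generate the chain, while duality supplies two. If both
    diagonal values vanish, c^-1 x + y has the value 1 + 1, where c = [y, N x]. *)
Lemma polarize (N : 'M[C]_q) x y : (forall u v, ip (N *m u) v = ip u (N *m v)) ->
  ip y (N *m x) != 0 -> exists a b, ip (a *: x + b *: y) (N *m (a *: x + b *: y)) != 0.
Proof.
move=> hN hxy.
have [hx|hx] := eqVneq (ip x (N *m x)) 0; last first.
  by exists 1, 0; rewrite scale1r scale0r addr0.
have [hy|hy] := eqVneq (ip y (N *m y)) 0; last first.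
  by exists 0, 1; rewrite scale1r scale0r add0r.
exists (ip y (N *m x))^-1, 1; set c := ip y _ in hxy *.
have hc : ip x (N *m y) = (c^*)%C by rewrite -hN (ipC hH).
rewrite scale1r mulmxDr -scalemxAr ipDl !ipDr !ipZl !ipZr hx hy hc -/c !mulr0 add0r addr0.
rewrite mulVf // conjc_inv mulVf ?conjc_eq0 //.
by rewrite -[1 + 1]/(2%:R) pnatr_eq0.
Qed.
End Isotropy.

Section JordanVectors.
Variable R : realType.
Local Notation C := (R[i]).
Variables (q : nat) (A H P : 'M[C]_q).
Hypothesis hH : adj_mx H = H.
Hypothesis hHu : H \in unitmx.
Hypothesis hA : H *m A = adj_mx A *m H.
Hypothesis hAP : A *m P = P *m A.
Hypothesis hPP : P *m P = P.
Hypothesis hP : P != 0.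
Hypothesis hHP : H *m P = adj_mx P *m H.
Local Notation ip := (ip H).
Local Notation shift_mx := (shift_mx A).

Lemma shift_mx_comm a i : P *m shift_mx a ^+ i = shift_mx a ^+ i *m P.
Proof.
elim: i => [|i IH]; first by rewrite expr0 -idmxE mul1mx mulmx1.
rewrite exprS -mulmxE mulmxA -[in RHS]mulmxA -IH mulmxA; congr (_ *m _).
by rewrite mulmxBr mulmxBl hAP scalar_mxC.
Qed.

Lemma ip_proj x y : ip (P *m x) y = ip x (P *m y).
Proof. by rewrite /ip adjmxM -!mulmxA (mulmxA _ H) -hHP !mulmxA. Qed.

Lemma form_shiftX a i : H *m shift_mx ((a^*)%C) ^+ i = adj_mx (shift_mx a ^+ i) *m H.
Proof.
elim: i => [|i IH]; first by rewrite !expr0 -idmxE adjmx1 mul1mx mulmx1.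
rewrite exprSr exprS -!mulmxE mulmxA IH adjmxM -!mulmxA; congr (_ *m _).
by rewrite /shift_mx mulmxBr adjmxB adj_scalar mulmxBl hA scalar_mxC.
Qed.

(** Here k is the length of a longest chain for [a] in the image of P: the first index at which the
    rank of N^k P stops dropping. It is positive because the eigenvector v is killed by N. *)
Lemma shift_mx_index a (v : 'cV_q) : v != 0 -> P *m v = v -> A *m v = a *: v ->
  exists k (x : 'cV_q), [/\ (0 < k)%N, P *m x = x, shift_mx a ^+ k *m x = 0, shift_mx a ^+ k.-1
      *m x != 0 &
     forall y : 'cV_q, P *m y = y -> shift_mx a ^+ k.+1 *m y = 0 -> shift_mx a ^+ k *m y = 0].
Proof.
move=> v0 hPv hAv; pose f k := \rank (shift_mx a ^+ k *m P).
have fS k : shift_mx a ^+ k.+1 *m P = shift_mx a *m (shift_mx a ^+ k *m P).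
  by rewrite exprS -mulmxE mulmxA.
have fle k : (f k.+1 <= f k)%N by rewrite /f fS mxrankM_maxr.
have ex : exists k, f k.+1 == f k.
  suff [k hk] : exists k : 'I_(f 0).+1, f k.+1 == f k by exists k.
  apply/existsP; apply: contraT; rewrite negb_exists => /forallP h.
  have hk k : (k <= (f 0).+1)%N -> (f k + k <= f 0)%N.
    elim: k => [|k IH] hk; first by rewrite addn0.
    have := h (Ordinal hk); have := fle k; have := IH (ltnW hk); rewrite /=; lia.
  by have := hk _ (leqnn _); lia.
case: (ex_minnP ex) => k /eqP hk kmin.
have stab y : P *m y = y -> shift_mx a ^+ k.+1 *m y = 0 -> shift_mx a ^+ k *m y = 0 :> 'cV_q.
  move=> hPy hy.
  have /submxP[D hD] : (shift_mx a ^+ k *m P <= shift_mx a ^+ k.+1 *m P)%MS.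
    have hs : (shift_mx a ^+ k.+1 *m P <= shift_mx a ^+ k *m P)%MS by rewrite fS submxMl.
    by have := mxrank_leqif_eq hs; rewrite /leqif -/(f _) -/(f _) hk eqxx => -[_ /esym /andP[]].
  by rewrite -hPy mulmxA hD -!mulmxA hPy hy mulmx0.
have k0 : (0 < k)%N.
  rewrite lt0n; apply: contra_neqN v0 => /eqP k0; move: stab; rewrite k0 => /(_ v hPv).
  rewrite expr1 expr0 -idmxE mul1mx; apply.
  by rewrite mulmxBl hAv mul_scalar_mx subrr.
have /nsubmx_witness[u [hu1 hu2]] : ~~ (shift_mx a ^+ k.-1 *m P <= shift_mx a ^+ k *m P)%MS.
  apply: contraT; rewrite negbK => /mxrankS; rewrite -/(f _) -/(f _) => hr.
  by have := kmin k.-1; have := fle k.-1; rewrite prednK //; lia.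
exists k, (P *m u); split=> //; first by rewrite mulmxA hPP.
  by rewrite mulmxA.
by rewrite mulmxA.
Qed.

(* If w = N^(k-1) x were orthogonal to the kernel of the adjoint of N^k, it would lie in the
   image of N^k, against the choice of k as the index where the kernels become stable. *)
Lemma jordan_vectors : exists (a : C) k (x y : 'cV_q),
  [/\ (0 < k)%N, P *m x = x /\ P *m y = y, shift_mx a ^+ k *m x = 0,
     shift_mx ((a^*)%C) ^+ k *m y = 0 & ip y (shift_mx a ^+ k.-1 *m x) != 0].
Proof.
have [a [v [v0 hPv hAv]]] := stable_eigenvector hAP hPP hP.
have [k [x [k0 hPx hx w0 stab]]] := shift_mx_index v0 hPv hAv.
pose w := shift_mx a ^+ k.-1 *m x.
have /nsubmx_witness[y [hy1 hy2]] : ~~ (adj_mx w *m H <= shift_mx ((a^*)%C) ^+ k)%MS.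
  apply: contra_neqN w0 => /submxP[D hD].
  have /(congr1 (@adj_mx R _ _)) : adj_mx w = D *m invmx H *m adj_mx (shift_mx a ^+ k).
    apply: (can_inj (mulmxK hHu)); rewrite hD -!mulmxA -form_shiftX.
    by rewrite !mulmxA mulmxKV.
  rewrite adjmxK [in RHS]adjmxM adjmxK; set u := adj_mx _ => hw.
  have hPw : P *m w = w by rewrite /w mulmxA shift_mx_comm -mulmxA hPx.
  (* P moves the preimage u into its image, where the kernels of N^k and N^(k+1) agree. As N w = N^k
     x = 0, this forces w = 0. *)
  have hw' : w = shift_mx a ^+ k *m (P *m u) by rewrite mulmxA -shift_mx_comm -mulmxA -hw hPw.
  rewrite -/w hw'; apply: stab; first by rewrite mulmxA hPP.
  by rewrite exprS -mulmxE -mulmxA -hw' /w mulmxA mulmxE -exprS prednK.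
exists a, k, x, (P *m y); split=> //.
- by rewrite mulmxA hPP.
- by rewrite mulmxA -shift_mx_comm -mulmxA hy1 mulmx0.
- rewrite ip_proj mulmxA shift_mx_comm -mulmxA hPx ipC // -/w.
  apply: contra hy2; rewrite conjc_eq0 => /eqP h; apply/eqP/matrixP => i j.
  by rewrite !ord1 [RHS]mxE.
Qed.

End JordanVectors.

(** * Quaternionic frames *)

Section Quaternionic.
Variable R : realType.
Local Notation C := (R[i]).
Implicit Types (cf : seq (cblock R)).
Variable n : nat.

Definition Jq : 'M[C]_(n + n) := block_mx 0 (- 1%:M) 1%:M 0.

Lemma Jq_cconj : cconj_mx Jq = Jq.
Proof. by rewrite /Jq cconj_block cconjN !cconj0 cconj1. Qed.
Lemma Jq_adj : adj_mx Jq = - Jq.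
Proof. by rewrite /Jq adj_block adjmxN !adjmx0 adjmx1 opp_block_mx opprK oppr0. Qed.
Lemma Jq_tr : Jq^T = - Jq.
Proof. by rewrite -[RHS]Jq_adj /adj_mx Jq_cconj. Qed.
Lemma Jq_sq : Jq *m Jq = - 1%:M.
Proof.
rewrite /Jq mulmx_block !mulmx0 !mul0mx !mulmx1 !mul1mx !addr0 !add0r.
by rewrite scalar_mx_block opp_block_mx oppr0.
Qed.

Lemma in_OmegaP (A : 'M[C]_(n + n)) : in_Omega A <-> A *m Jq = Jq *m cconj_mx A.
Proof.
split=> [[A1 [A2 ->]]|].
  rewrite /Jq cconj_block !cconjN !cconjK !mulmx_block !mulmx0 !mul0mx.
  by rewrite !mulmxN !mulNmx !mulmx1 !mul1mx !addr0 !add0r !opprK.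
rewrite -[A]submxK; move: (ulsubmx A) (ursubmx A) (dlsubmx A) (drsubmx A) => a b c d.
rewrite /Jq cconj_block !mulmx_block !mulmx0 !mul0mx !mulmxN !mulNmx !mulmx1 !mul1mx.
rewrite !addr0 !add0r => /eq_block_mx [hb _ hd _].
by exists a, (- c); rewrite cconjN opprK hb hd.
Qed.

Definition qframe k (W : 'M[C]_(n + n, k)) : 'M[C]_(n + n, k + k) :=
  row_mx W (Jq *m cconj_mx W).

Lemma qframe_Omega (W : 'M[C]_(n + n, n)) : in_Omega (qframe W).
Proof.
rewrite -[W]vsubmxK; move: (usubmx W) (dsubmx W) => a b.
exists a, (- b); rewrite /qframe cconj_col /Jq mul_block_col !mul0mx mulNmx !mul1mx.
by rewrite add0r addr0 block_mxEh cconjN opprK.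
Qed.

Variables (A H : 'M[C]_(n + n)).
Hypothesis OA : in_Omega A.
Hypothesis OH : in_Omega H.
Hypothesis hHu : H \in unitmx.
Hypothesis hH : adj_mx H = H.
Hypothesis hA : H *m A = adj_mx A *m H.

Let K := H *m Jq.

(** Transposing H J gives -J conj(H), and membership of H in Omega turns this into -H J. *)
Lemma qform_tr : K^T = - K.
Proof.
have hT : H^T = cconj_mx H by rewrite -{1}hH tr_adj_mx.
by rewrite /K trmx_mul Jq_tr hT mulNmx; congr (- _); move/in_OmegaP: OH.
Qed.
Lemma qform_selfadj : adj_mx A *m K = K *m cconj_mx A.
Proof. by rewrite /K mulmxA -hA -!mulmxA; congr (_ *m _); exact/in_OmegaP. Qed.

Lemma bp_ip x y : bp K x y = ip H x (Jq *m cconj_mx y).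
Proof. by rewrite /bp /ip /K !mulmxA. Qed.

(** Together with [qdual2] this expresses every Gram block that involves the conjugate columns J
    conj(W) through the H- and K-Gram matrices of the original columns. *)
Lemma qdual k1 k2 (U : 'M[C]_(n + n, k1)) (W : 'M[C]_(n + n, k2)) :
  adj_mx (Jq *m cconj_mx U) *m H *m W = - cconj_mx (adj_mx U *m K *m cconj_mx W).
Proof.
rewrite adjmxM Jq_adj adj_cconj /K !cconjM cconjK Jq_cconj /adj_mx cconjT cconjK.
rewrite mulmxN !mulNmx; congr (- (_ *m _)); rewrite -!mulmxA; congr (_ *m _).
have := (in_OmegaP H).1 OH => /(congr1 (@cconj_mx R _ _)).
by rewrite !cconjM cconjK Jq_cconj.
Qed.

Lemma qdual2 k1 k2 (U : 'M[C]_(n + n, k1)) (W : 'M[C]_(n + n, k2)) :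
  adj_mx (Jq *m cconj_mx U) *m H *m (Jq *m cconj_mx W) = cconj_mx (adj_mx U *m H *m W).
Proof.
rewrite qdual [cconj_mx (Jq *m _)]cconjM cconjK Jq_cconj /K -!mulmxA (mulmxA Jq Jq) Jq_sq.
by rewrite mulNmx !mulmxN cconjN opprK mul1mx !mulmxA.
Qed.

(** Being antilinear and commuting with A, v |-> J conj(v) carries generalized eigenvectors for
    conj(a) to those for a. *)
Lemma shift_mx_Jq a i x : shift_mx A a ^+ i *m (Jq *m cconj_mx x) =
  Jq *m cconj_mx (shift_mx A ((a^*)%C) ^+ i *m x) :> 'cV_(n + n).
Proof.
have ha : cconj_mx ((a^*)%C)%:M = a%:M :> 'M[C]_(n + n).
  by rewrite /cconj_mx map_scalar_mx /= conjcK.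
have hJ : shift_mx A a *m Jq = Jq *m cconj_mx (shift_mx A ((a^*)%C)).
  rewrite /shift_mx mulmxBl cconjD cconjN mulmxDr mulmxN ha.
  by rewrite scalar_mxC ((in_OmegaP A).1 OA).
elim: i => [|i IH]; first by rewrite !expr0 -idmxE !mul1mx.
rewrite [in LHS]exprS -mulmxE -mulmxA IH mulmxA hJ -mulmxA -cconjM mulmxA mulmxE.
by rewrite -exprS.
Qed.

(** * Extending a frame inside its orthogonal complement *)

Section Extension.
Variables (k : nat) (W : 'M[C]_(n + n, k)) (cf : seq (cblock R)).
Hypothesis fW : frame A H K W cf.

Let G := block_mx (cfNmx k cf) 0 0 (cfNmx k cf).
Let T := block_mx (cfMmx k cf) 0 0 (cconj_mx (cfMmx k cf)).
Let S := qframe W.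

Lemma qframe_gram : adj_mx S *m H *m S = G.
Proof.
case: fW => hk hM hN hK; rewrite /S /qframe adj_row mul_col_mx mul_col_row.
rewrite qdual2 hN cfNmx_cconj qdual hK cconj0 oppr0 mulmxA.
by rewrite -[adj_mx W *m H *m Jq]mulmxA hK.
Qed.

Lemma qframe_mul : A *m S = S *m T.
Proof.
case: fW => hk hM hN hK; rewrite /S /qframe mul_mx_row mul_row_block !mulmx0 addr0 add0r hM.
rewrite !mulmxA ((in_OmegaP A).1 OA) -[Jq *m _ *m cconj_mx W]mulmxA -cconjM hM.
by rewrite cconjM mulmxA.
Qed.

Lemma qgram_sq : G *m G = 1%:M.
Proof.
case: fW => hk _ _ _; rewrite /G mulmx_block !mulmx0 !mul0mx !addr0 !add0r cfNmx_sq //.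
by rewrite -scalar_mx_block.
Qed.
Lemma qgram_adj : adj_mx G = G.
Proof. by rewrite /G adj_block !adjmx0 cfNmx_adj. Qed.

Let L := adj_mx S *m H.
(* The H-orthogonal projection onto the complement of the quaternionic span of [W]. *)
Let P := 1%:M - S *m G *m L.

Lemma compl_rowS : L *m S = G. Proof. exact: qframe_gram. Qed.

Lemma compl_rowP : L *m P = 0.
Proof. by rewrite /P mulmxBr mulmx1 !mulmxA compl_rowS qgram_sq mul1mx subrr. Qed.

Lemma compl_rowA : L *m A = adj_mx T *m L.
Proof. by rewrite /L -mulmxA hA !mulmxA -!adjmxM qframe_mul. Qed.

(** The relation G T = T^* G, multiplied on both sides by the involution G. It lets A pass through
    the projection. *)
Lemma gram_selfadj : T *m G = G *m adj_mx T.
Proof.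
have h : G *m T = adj_mx T *m G by rewrite -compl_rowS -mulmxA -qframe_mul mulmxA compl_rowA
    mulmxA.
by rewrite -[T *m G]mul1mx -qgram_sq -mulmxA (mulmxA G T) h -mulmxA qgram_sq mulmx1.
Qed.

Lemma compl_comm : A *m P = P *m A.
Proof.
rewrite /P mulmxBr mulmxBl mulmx1 mul1mx; congr (_ - _).
rewrite -[S *m G *m L *m A]mulmxA compl_rowA (mulmxA A) (mulmxA A) qframe_mul -(mulmxA S T)
    gram_selfadj.
by rewrite (mulmxA S) (mulmxA _ (adj_mx T)).
Qed.
Lemma compl_idem : P *m P = P.
Proof. by rewrite {1}/P mulmxBl mul1mx -(mulmxA _ L P) compl_rowP mulmx0 subr0. Qed.
Lemma compl_selfadj : H *m P = adj_mx P *m H.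
Proof.
rewrite /P mulmxBr adjmxB mulmxBl mulmx1 adjmx1 mul1mx; congr (_ - _).
by rewrite /L !adjmxM adjmxK hH qgram_adj !mulmxA.
Qed.

(** The identity of size 2k factors through a space of dimension 2n. *)
Lemma frame_size : (k <= n)%N.
Proof.
have h1 : \rank (G *m (L *m S)) = (k + k)%N by rewrite compl_rowS qgram_sq mxrank1.
have : (\rank (G *m (L *m S)) <= n + n)%N.
  by rewrite mulmxA (leq_trans (mxrankM_maxr _ _)) // rank_leq_row.
rewrite h1; lia.
Qed.

Lemma compl_neq0 : (k < n)%N -> P != 0.
Proof.
move=> hk; apply/eqP; rewrite /P => /eqP; rewrite subr_eq0 => /eqP h1.
have : (\rank (1%:M : 'M[C]_(n + n)) <= k + k)%N.
  by rewrite h1 -mulmxA (leq_trans (mxrankM_maxl _ _)) // rank_leq_col.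
by rewrite mxrank1; lia.
Qed.

(** The image of P is orthogonal to W and to J conj(W); the second orthogonality is the vanishing of
    the K-block between the two frames. *)
Lemma orth_frame k2 (W2 : 'M[C]_(n + n, k2)) cf2 : P *m W2 = W2 ->
  frame A H K W2 cf2 -> frame A H K (row_mx W W2) (cf ++ cf2).
Proof.
move=> hP2 f2; have : L *m W2 = 0 by rewrite -hP2 mulmxA compl_rowP mul0mx.
rewrite /L /S /qframe adj_row mul_col_mx mul_col_mx -col_mx0 => /eq_col_mx [h1].
rewrite qdual => /eqP; rewrite oppr_eq0 => /eqP h2.
apply: (frame_cat hH qform_tr) => //.
by rewrite -[LHS]cconjK h2 cconj0.
Qed.

Lemma compl_chain l N x : (forall i, P *m (N ^+ i *m x) = N ^+ i *m x) ->
  P *m chain l N x = chain l N x.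
Proof.
move=> h; apply/matrixP => i j.
have := congr1 (fun M : 'cV_(n + n) => M i 0) (h (l.-1 - j)%N).
by rewrite -col_chain mulmx_col !mxE => ->; rewrite ?mxE.
Qed.

Lemma frame_extend : (k < n)%N -> all (@cb_valid R) cf ->
  exists k' (W' : 'M[C]_(n + n, k')) cf',
    [/\ (k < k')%N, frame A H K W' cf' & all (@cb_valid R) cf'].
Proof.
move=> hk hv.
pose Pr u := P *m u = u :> 'cV_(n + n).
have PrZD a u v : Pr u -> Pr v -> Pr (a *: u + v).
  by rewrite /Pr mulmxDr -scalemxAr => -> ->.
have PrA u : Pr u -> Pr (A *m u) by rewrite /Pr mulmxA -compl_comm -mulmxA => ->.
have PrN := shift_mx_stable PrZD PrA.
have [a [l [x [y [l0 [hPx hPy] hx hy hc]]]]] :=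
  jordan_vectors hH hHu hA compl_comm compl_idem (compl_neq0 hk) compl_selfadj.
have [ha|ha] := eqVneq ((a^*)%C) a.
  have har : (complex.Re a)%:C%C = a by move: ha; case: (a) => u v [] /eqP; rewrite eqNr => /eqP
      ->.
  rewrite ha in hy.
  have hself u v : ip H (shift_mx A a ^+ l.-1 *m u) v = ip H u (shift_mx A a ^+ l.-1 *m v).
    by rewrite -{1}ha ip_shiftX.
  (* For a real eigenvalue x and y lie in the same generalized eigenspace, so a combination of them
     is again annihilated by N^l. *)
  have [b [c]] := polarize hH hself hc; set x' := b *: x + c *: y => hc'.
  have hPx' : Pr x' by apply: (PrZD) => //; apply: (stableZ PrZD).
  have hx' : shift_mx A a ^+ l *m x' = 0 by rewrite mulmxDr -!scalemxAr hx hy !scaler0 addr0.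
  rewrite -har in hx' hc'.
  have [z [Pz hz hzz]] := real_normal hH hA PrZD PrA l0 hPx' hx' hc'.
  have fz := real_frame qform_tr hA qform_selfadj hz hzz.
  have f := orth_frame (compl_chain _ (fun i => PrN _ i z Pz)) fz.
  do 3 eexists; split; [|exact: f|by rewrite all_cat hv /= l0].
  by rewrite -addn1 leq_add2l.
(* Passing to conj(a) exchanges x and y, since the two shifts are adjoint; a valid block needs
   positive imaginary part. *)
wlog ha' : a x y hPx hPy hx hy hc ha / 0 < complex.Im a.
  move=> hw; have [h|h|h] := ltgtP 0 (complex.Im a); first exact: (hw a x y).
    apply: (hw ((a^*)%C) y x hPy hPx hy).
    - by rewrite conjcK.
    - by rewrite -(ip_shiftX hA) conjcK (ipC hH) conjc_eq0.
    - by rewrite conjcK eq_sym.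
    - by move: h; case: (a) => u v /=; rewrite oppr_gt0.
  by case/eqP: ha; move: h; case: (a) => u v /= <-; rewrite /conjc oppr0.
have [x' [Px' hx' hzx]] := pair_normal PrZD PrA l0 hPx hx hc.
have hX b i w : shift_mx A b ^+ l *m w = 0 -> shift_mx A b ^+ l *m (shift_mx A b ^+ i *m w) = 0
    :> 'cV_(n+n).
  by move=> hw; rewrite mulmxA mulmxE -exprD addnC exprD -mulmxE -mulmxA hw mulmx0.
have f : frame A H K (row_mx (chain l (shift_mx A a) x') (chain l (shift_mx A ((a^*)%C)) y))
     [:: inr (l, complex.Re a, complex.Im a)].
  apply: (pair_frame hH qform_tr hA qform_selfadj) => //.
  - by move=> i j; apply: (nonreal_isotropic hA ha (i := l) (j := l)); apply: hX.
  - move=> i j; apply: (nonreal_isotropic hA (a := (a^*)%C) (i := l) (j := l)); try exact: hX.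
    by rewrite conjcK eq_sym.
  (* The second vector, once sent through v |-> J conj(v), belongs to the eigenvalue a like the
     first, so isotropy at a nonreal eigenvalue applies. *)
  - move=> i j; rewrite bp_ip; apply: (nonreal_isotropic hA ha (i := l) (j := l)); first exact:
      hX.
    by rewrite shift_mx_Jq hX // cconj0 mulmx0.
have hPf : P *m row_mx (chain l (shift_mx A a) x') (chain l (shift_mx A ((a^*)%C)) y) =
   row_mx (chain l (shift_mx A a) x') (chain l (shift_mx A ((a^*)%C)) y).
  by rewrite mul_mx_row !compl_chain // => i; apply: PrN.
do 3 eexists; split; [|exact: (orth_frame hPf f)|by rewrite all_cat hv /= l0 ha'].
by lia.
Qed.
End Extension.

Lemma canonical_frame_exists : exists (W : 'M[C]_(n + n, n)) cf,
  frame A H K W cf /\ all (@cb_valid R) cf.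
Proof.
suff h d : forall k (W : 'M[C]_(n + n, k)) cf, (n - k <= d)%N -> frame A H K W cf ->
    all (@cb_valid R) cf ->
    exists (W : 'M[C]_(n + n, n)) cf, frame A H K W cf /\ all (@cb_valid R) cf.
  by apply: (h n _ 0 [::]) => //; [rewrite leq_subr|exact: frame0].
elim: d => [|d IH] k W cf hd fW hv; have hk := frame_size fW.
  have hk' : k = n by lia.
  by subst k; exists W, cf.
have [hkn|hkn] := ltnP k n; last first.
  by have hk' : k = n by [lia]; subst k; exists W, cf.
have [k' [W' [cf' [hk' f' v']]]] := frame_extend fW hkn hv.
by apply: (IH k' W' cf') => //; lia.
Qed.

Lemma frame_canonical (W : 'M[C]_(n + n, n)) cf : frame A H K W cf ->
  all (@cb_valid R) cf -> canonical_reduction A H (qframe W) cf.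
Proof.
move=> fW hv; have hS := qframe_gram fW; have [hk _ _ _] := fW.
have Su : qframe W \in unitmx.
  have : (block_mx (cfNmx n cf) 0 0 (cfNmx n cf) *m (adj_mx (qframe W) *m H)) *m qframe W = 1%:M.
    by rewrite -mulmxA hS (qgram_sq fW).
  by case/mulmx1_unit.
split=> //; first exact: qframe_Omega.
split; last exact: hS.
by rewrite -mulmxA (qframe_mul fW) mulKmx // bdiag_conj.
Qed.

(** The left half of S is the frame. Its K-condition is the upper right Gram block W^* H J conj(W),
    which the canonical form makes zero. *)
Lemma canonical_frame S cf : canonical_reduction A H S cf ->
  exists W : 'M[C]_(n + n, n), S = qframe W /\ frame A H K W cf.
Proof.
case=> -[A1 [A2 hS]] Su hv hs [h1 h2]; exists (col_mx A1 (- A2)).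
have SE : S = qframe (col_mx A1 (- A2)).
  rewrite hS /qframe cconj_col /Jq mul_block_col !mul0mx mulNmx !mul1mx.
  by rewrite add0r addr0 block_mxEh cconjN opprK.
split=> //; move: h1 h2; rewrite SE; set W := col_mx _ _ => h1 h2.
have {}h1 : A *m qframe W = qframe W *m block_mx (cfMmx n cf) 0 0 (bdiag n (cf_M' cf)).
  by rewrite -h1 !mulmxA mulmxV ?mul1mx // -SE.
move: h1; rewrite /qframe mul_mx_row mul_row_block !mulmx0 addr0 add0r => /eq_row_mx [h1 _].
move: h2; rewrite /qframe adj_row mul_col_mx mul_col_row => /eq_block_mx [h2 h3 _ _].
by split=> //; rewrite -h3 /K !mulmxA.
Qed.

End Quaternionic.

(** * Powers of canonical blocks *)

Section Composition.
Variable R : realType.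
Local Notation C := (R[i]).
Implicit Types (cf : seq (cblock R)).

Lemma intertwineX p q (A : 'M[C]_p) (S : 'M_(p, q)) (D : 'M_q) m :
  A *m S = S *m D -> A ^+ m *m S = S *m D ^+ m.
Proof.
move=> h; elim: m => [|m IH]; first by rewrite !expr0 -!idmxE mul1mx mulmx1.
by rewrite exprS -mulmxE -mulmxA IH mulmxA h -mulmxA mulmxE -exprS.
Qed.

Lemma frame_comp p k k' (M H K : 'M[C]_p) (W : 'M_(p, k)) (T : 'M_(k, k')) cf cf' :
  frame M H K W cf -> frame (cfMmx k cf) (cfNmx k cf) 0 T cf' -> frame M H K (W *m T) cf'.
Proof.
move=> [s1 a1 b1 c1] [s2 a2 b2 _]; split=> //.
- by rewrite mulmxA a1 -mulmxA a2 mulmxA.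
- by rewrite adjmxM !mulmxA -b2 -b1 !mulmxA.
- by rewrite adjmxM cconjM !mulmxA -[adj_mx T *m _ *m K]mulmxA -[_ *m _ *m cconj_mx W]mulmxA c1
    mulmx0 mul0mx.
Qed.

(** T is sought for the complex pair alone, with form 0: the K-condition for W T reduces to the one
    for W. *)
Lemma frame_compX p k k' m (M H K : 'M[C]_p) (W : 'M_(p, k)) (T : 'M_(k, k')) cf cf' :
  frame M H K W cf -> frame (cfMmx k cf ^+ m) (cfNmx k cf) 0 T cf' ->
  frame (M ^+ m) H K (W *m T) cf'.
Proof.
move=> [s1 a1 b1 c1] [s2 a2 b2 _].
have a1m := intertwineX m a1.
split=> //.
- by rewrite mulmxA a1m -mulmxA a2 mulmxA.
- by rewrite adjmxM !mulmxA -b2 -b1 !mulmxA.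
- by rewrite adjmxM cconjM !mulmxA -[adj_mx T *m _ *m K]mulmxA -[_ *m _ *m cconj_mx W]mulmxA c1
    mulmx0 mul0mx.
Qed.

(** Exchanging the two chains repairs a power whose imaginary part came out negative. *)
Lemma frame_flip k (x y : R) : exists T : 'M[C]_(k + k),
  frame (cfMmx (k + k) [:: inr (k, x, y)]) (cfNmx (k + k) [:: inr (k, x, y)]) 0 T
    [:: inr (k, x, - y)].
Proof.
exists (block_mx 0 1%:M 1%:M 0); split; first by rewrite /= addn0 addnn.
- rewrite !cfMmx_inr opprK; move: (Jm k _) (Jm k _) => J1 J2.
  by rewrite !mulmx_block !mulmx0 !mul0mx !mulmx1 !mul1mx !addr0 !add0r.
- rewrite !cfNmx_inr adj_block !adjmx0 !adjmx1; move: (Qm k 1) => Q.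
  by rewrite !mulmx_block !mulmx0 !mul0mx !mulmx1 !mul1mx !addr0 !add0r.
- by rewrite mulmx0 mul0mx.
Qed.

(** With equal eigenvalues the pair is a hyperbolic plane over one Jordan block; (u + v)/sqrt 2 and
    (u - v)/sqrt 2 diagonalize it to Q and -Q. *)
Lemma frame_split k (x : R) : exists T : 'M[C]_(k + k),
  frame (cfMmx (k + k) [:: inr (k, x, 0)]) (cfNmx (k + k) [:: inr (k, x, 0)]) 0 T
    [:: inl (k, x, true); inl (k, x, false)].
Proof.
pose c : C := (sqrtC 2%:R)^-1.
have c2 : c * c = 2%:R^-1 by rewrite -expr2 exprVn sqrtCK.
have cr : ((c)^*)%C = c.
  by apply/CrealP; rewrite realV ger0_real // sqrtC_ge0 ler0n.
exists (c *: block_mx 1%:M 1%:M 1%:M (- 1%:M)); split; first by rewrite /= addn0.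
- rewrite -[[:: inl _; _]]cat1s cfMmx_inr cfMmx_cat /= ?addn0 // !cfMmx_inl.
  rewrite -scalemxAr -scalemxAl oppr0; move: (Jm k _) => J1.
  rewrite !mulmx_block !mulmx0 !mul0mx !mulmx1 !mul1mx.
  by rewrite !mulmxN !mulNmx !addr0 !add0r !mulmx1 !mul1mx.
- rewrite -[[:: inl _; _]]cat1s cfNmx_inr cfNmx_cat /= ?addn0 // !cfNmx_inl.
  rewrite adjmxZ cr -!scalemxAl -scalemxAr scalerA c2 adj_block adjmxN !adjmx1.
  have h2 : Qm k 1 + Qm k 1 = 2%:R *: Qm k 1 :> 'M[C]_k by rewrite scaler_nat mulr2n.
  have h2' : - Qm k 1 - Qm k 1 = 2%:R *: Qm k (-1) :> 'M[C]_k.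
    rewrite -opprD h2 -scalerN; congr (_ *: _); apply/matrixP => i j.
    by rewrite !mxE !antidiagE; case: ifP => _; rewrite ?oppr0.
  have <- : 2%:R^-1 *: block_mx (Qm k 1 + Qm k 1) 0 0 (- Qm k 1 - Qm k 1) =
      block_mx (Qm k 1) 0 0 (Qm k (-1)) :> 'M[C]_(k + k).
    by rewrite scale_block_mx !scaler0 h2 h2' !scalerA mulVf ?pnatr_eq0 // !scale1r.
  congr (_ *: _); move: (Qm k 1) => Q.
  rewrite !mulmx_block !mulmx0 !mulmxN !mulNmx !mulmx1 !mul1mx !addr0 !add0r.
  by rewrite subrr addNr.
- by rewrite mulmx0 mul0mx.
Qed.

Lemma dsum_frame k1 k2 l1 l2 (M1 N1 : 'M[C]_k1) (M2 N2 : 'M[C]_k2)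
    (W1 : 'M_(k1, l1)) (W2 : 'M_(k2, l2)) cf1 cf2 :
  frame M1 N1 0 W1 cf1 -> frame M2 N2 0 W2 cf2 ->
  frame (block_mx M1 0 0 M2) (block_mx N1 0 0 N2) 0 (block_mx W1 0 0 W2) (cf1 ++ cf2).
Proof.
move=> [s1 a1 b1 _] [s2 a2 b2 _]; split.
- by rewrite map_cat sumn_cat s1 s2.
- by rewrite cfMmx_cat // !mulmx_block !mulmx0 !mul0mx !addr0 !add0r a1 a2.
- rewrite cfNmx_cat // adj_block !adjmx0 mulmx_block !mulmx0 !mul0mx !addr0 !add0r.
  by rewrite mulmx_block !mulmx0 !mul0mx !addr0 !add0r b1 b2.
- by rewrite mulmx0 mul0mx.
Qed.

Lemma expr_block k1 k2 (M1 : 'M[C]_k1) (M2 : 'M[C]_k2) m :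
  block_mx M1 0 0 M2 ^+ m = block_mx (M1 ^+ m) 0 0 (M2 ^+ m).
Proof.
elim: m => [|m IH]; first by rewrite !expr0 -!idmxE -scalar_mx_block.
by rewrite !exprS -!mulmxE IH mulmx_block !mulmx0 !mul0mx !addr0 !add0r.
Qed.

Lemma Qm_Jm k (a b : C) : Qm k b *m Jm k a = (Jm k a)^T *m Qm k b.
Proof.
apply/matrixP => i j; have hi := ltn_ord i; have hj := ltn_ord j.
rewrite mxE (bigD1 (rev_ord i)) //= big1 ?addr0; last first.
  move=> l hl; rewrite [Qm _ _ _ _]mxE antidiagE; case: ifPn => h; last by rewrite mul0r.
  by move: hl; rewrite -val_eqE /=; lia.
rewrite [RHS]mxE (bigD1 (rev_ord j)) //= big1 ?addr0; last first.
  move=> l hl; rewrite [Qm _ _ _ _]mxE antidiagE; case: ifPn => h; last by rewrite mulr0.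
  by move: hl; rewrite -val_eqE /=; lia.
rewrite !mxE !antidiagE /jordan_entry /= mulrC.
have -> : (i + (k - i.+1) == k.-1)%N = true by lia.
have -> : (k - j.+1 + j == k.-1)%N = true by lia.
congr (_ * _); have -> : (k - i.+1 == j :> nat)%N = (k - j.+1 == i :> nat)%N by lia.
by have -> : (j == (k - i.+1).+1 :> nat) = (i == (k - j.+1).+1 :> nat) by lia.
Qed.

Lemma Jm_cconj k (a : C) : cconj_mx (Jm k a) = Jm k ((a^*)%C).
Proof.
apply/matrixP => i j; rewrite !mxE /jordan_entry.
by case: ifP => _ //; case: ifP => _; rewrite ?conjc1 ?conjc0.
Qed.

Lemma dsum_selfadj k1 k2 (N1 M1 : 'M[C]_k1) (N2 M2 : 'M[C]_k2) :
  N1 *m M1 = adj_mx M1 *m N1 -> N2 *m M2 = adj_mx M2 *m N2 ->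
  block_mx N1 0 0 N2 *m block_mx M1 0 0 M2 =
  adj_mx (block_mx M1 0 0 M2) *m block_mx N1 0 0 N2.
Proof.
by move=> h1 h2; rewrite adj_block !adjmx0 !mulmx_block !mulmx0 !mul0mx !addr0 !add0r h1 h2.
Qed.

Lemma antidiag_selfadj k (Q M1 M2 : 'M[C]_k) :
  Q *m M1 = adj_mx M2 *m Q -> Q *m M2 = adj_mx M1 *m Q ->
  block_mx 0 Q Q 0 *m block_mx M1 0 0 M2 =
  adj_mx (block_mx M1 0 0 M2) *m block_mx 0 Q Q 0.
Proof.
by move=> h1 h2; rewrite adj_block !adjmx0 !mulmx_block !mulmx0 !mul0mx !addr0 !add0r h1 h2.
Qed.

Lemma cfNmx_selfadj k cf : sumn (map (@cb_size R) cf) = k ->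
  cfNmx k cf *m cfMmx k cf = adj_mx (cfMmx k cf) *m cfNmx k cf.
Proof.
elim: cf k => [|b cf IH] k /= <-; first by rewrite [LHS]flatmx0 [RHS]flatmx0.
rewrite -cat1s cfNmx_cat ?cfMmx_cat /= ?addn0 //; apply: dsum_selfadj; last exact: IH.
case: b => [[[l c] e]|[[l x] y]] /=.
  by rewrite cfMmx_inl cfNmx_inl Qm_Jm /adj_mx Jm_cconj conjc_real.
rewrite -addnn cfMmx_inr cfNmx_inr.
by apply: antidiag_selfadj; rewrite Qm_Jm /adj_mx Jm_cconj /conjc ?opprK.
Qed.

Lemma selfadjX p (M H : 'M[C]_p) m : H *m M = adj_mx M *m H ->
  H *m M ^+ m = adj_mx (M ^+ m) *m H.
Proof.
move=> hM; elim: m => [|m IH]; first by rewrite expr0 -idmxE adjmx1 mul1mx mulmx1.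
by rewrite exprS -mulmxE mulmxA hM -mulmxA IH mulmxA -adjmxM mulmxE -exprSr exprS.
Qed.

End Composition.

(** * Jordan chains under an m-th power *)

Section PowerVectors.
Variable R : realType.
Local Notation C := (R[i]).
Variables (p : nat) (M H : 'M[C]_p).

Lemma scalar_mxX (a : C) m : (a%:M : 'M[C]_p) ^+ m = (a ^+ m)%:M.
Proof.
elim: m => [|m IH]; first by rewrite !expr0 -idmxE.
by rewrite !exprS IH -mulmxE -scalar_mxM.
Qed.

Lemma shift_mx_pow (a : C) m k x (c := (a ^+ m.-1) *+ m) : (0 < m)%N -> (0 < k)%N ->
  shift_mx M a ^+ k *m x = 0 ->
  shift_mx (M ^+ m) (a ^+ m) ^+ k *m x = 0 /\
  shift_mx (M ^+ m) (a ^+ m) ^+ k.-1 *m x = (c ^+ k.-1) *: (shift_mx M a ^+ k.-1 *m x) :> 'cV_p.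
Proof.
move=> m0 k0 hx.
have cM : GRing.comm M a%:M by rewrite /GRing.comm -!mulmxE scalar_mxC.
pose q := \sum_(i < m) M ^+ (m.-1 - i) * a%:M ^+ i.
have hn : shift_mx (M ^+ m) (a ^+ m) = shift_mx M a * q.
  by rewrite /shift_mx -scalar_mxX subrXX_comm.
have cq : GRing.comm q (shift_mx M a).
  have c1 : GRing.comm (shift_mx M a) M by apply/commr_sym/commrB.
  have c2 : GRing.comm (shift_mx M a) a%:M by apply/commr_sym/commrB => //; apply/commr_sym.
  by apply/commr_sym/commr_sum => i _; apply: commrM; apply: commrX.
have hnX j : shift_mx (M ^+ m) (a ^+ m) ^+ j = q ^+ j * shift_mx M a ^+ j.
  by rewrite hn exprMn_comm; [apply/commrX/commr_sym/commrX/commr_sym|exact/commr_sym].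
split; first by rewrite hnX -mulmxE -mulmxA hx mulmx0.
rewrite hnX -mulmxE -mulmxA; set w := _ *m x.
have hw : M *m w = a *: w.
  apply/eqP; rewrite -subr_eq0 -mul_scalar_mx -mulmxBl /w mulmxA mulmxE -/(shift_mx M a) -exprS
      prednK //.
  by rewrite hx.
have hMw i : M ^+ i *m w = a ^+ i *: w.
  elim: i => [|i IH]; first by rewrite !expr0 -idmxE mul1mx scale1r.
  by rewrite exprS -mulmxE -mulmxA IH -scalemxAr hw scalerA -exprSr.
have hqw : q *m w = c *: w.
  rewrite /q mulmx_suml (eq_bigr (fun _ => a ^+ m.-1 *: w)).
    by rewrite sumr_const card_ord /c scalerMnl.
  move=> i _; rewrite -mulmxE -mulmxA scalar_mxX mul_scalar_mx -scalemxAr hMw scalerA -exprD.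
  by congr (_ ^+ _ *: _); have := ltn_ord i; lia.
elim: k.-1 => [|j IH]; first by rewrite !expr0 -idmxE mul1mx scale1r.
by rewrite exprS -mulmxE -mulmxA IH -scalemxAr hqw scalerA -exprSr.
Qed.
End PowerVectors.

Section UnitVectors.
Variable R : realType.
Local Notation C := (R[i]).

(** The index is a natural number, so that shifts become subtraction; out of range the vector is
    0. *)
Definition ev k (j : nat) : 'cV[C]_k := \col_(i < k) (i == j :> nat)%:R.

Lemma evE k j (hj : (j < k)%N) : ev k j = col (Ordinal hj) 1%:M.
Proof. by apply/matrixP => i i'; rewrite !mxE -val_eqE. Qed.

Lemma mul_ev p k (A : 'M[C]_(p, k)) j (hj : (j < k)%N) : A *m ev k j = col (Ordinal hj) A.
Proof. by rewrite evE mulmx_col mulmx1. Qed.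

Lemma shift_mx_ev k a j : (j < k)%N ->
  shift_mx (Jm k a) a *m ev k j = if (0 < j)%N then ev k j.-1 else 0.
Proof.
move=> hj; rewrite (mul_ev _ hj); apply/matrixP => i i'.
rewrite !mxE /jordan_entry -val_eqE /=.
case: posnP => [j0|jp]; rewrite !mxE.
  by rewrite j0; case: eqP => _; rewrite ?mulr1n ?mulr0n subrr.
have -> : (i == j.-1 :> nat) = (j == i.+1) by lia.
by case: (altP (i =P j :> nat)) => [->|_]; case: eqP => //=;
  rewrite ?mulr1n ?mulr0n ?subrr ?subr0 //; lia.
Qed.

Lemma shift_mxX_ev k a i j : (j < k)%N ->
  shift_mx (Jm k a) a ^+ i *m ev k j = if (i <= j)%N then ev k (j - i) else 0.
Proof.
move=> hj; elim: i => [|i IH]; first by rewrite expr0 -idmxE mul1mx subn0.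
rewrite exprS -mulmxE -mulmxA IH; case: (leqP i j) => hij; last first.
  by rewrite mulmx0 ltnNge (ltnW hij).
rewrite shift_mx_ev; last by lia.
by rewrite subn_gt0; case: ifP => // _; rewrite subnS.
Qed.

Lemma ip_Qm k (s : C) i j : (i < k)%N -> (j < k)%N ->
  ip (Qm k s) (ev k i) (ev k j) = if (i + j == k.-1)%N then s else 0.
Proof.
move=> hi hj; rewrite (evE hi) (evE hj) -gram_ip adjmx1 mul1mx mulmx1 mxE.
by rewrite antidiagE.
Qed.

Lemma tr_zero_form p : (0 : 'M[C]_p)^T = - 0. Proof. by rewrite trmx0 oppr0. Qed.
Lemma selfadj_zero_form p (M : 'M[C]_p) : adj_mx M *m 0 = 0 *m cconj_mx M :> 'M[C]_p.
Proof. by rewrite mulmx0 mul0mx. Qed.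

(** The last unit vector generates the chain, and its top pairing for the power is e (m
    l^(m-1))^(k-1). The sign is kept when l^(m-1) > 0. *)
Lemma pow_real k (l : R) e m : (0 < k)%N -> l != 0 -> (0 < m)%N ->
  exists e' (W : 'M[C]_(k, k)), (0 < l ^+ m.-1 -> e' = e) /\
    frame (cfMmx k [:: inl (k, l, e)] ^+ m) (cfNmx k [:: inl (k, l, e)]) 0 W
      [:: inl (k, l ^+ m, e')].
Proof.
move=> k0 l0 m0.
have hM := selfadjX m (cfNmx_selfadj (_ : sumn (map (@cb_size R) [:: inl (k, l, e)]) = k)).
have {}hM := hM (addn0 k); have hH := cfNmx_adj k [:: inl (k, l, e)].
move: hM hH; rewrite cfMmx_inl cfNmx_inl => hM hH.
set M := Jm k _ in hM *; set H := Qm k _ in hM hH *.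
pose x := ev k k.-1; pose c : C := (l ^+ m.-1 *+ m)%:C%C.
have hx0 : shift_mx M l%:C%C ^+ k *m x = 0.
  rewrite shift_mxX_ev; last by rewrite prednK.
  by have -> : (k <= k.-1)%N = false by lia.
have [hx1 hx2] := shift_mx_pow m0 k0 hx0.
have lm : (l%:C%C) ^+ m = (l ^+ m)%:C%C by rewrite rmorphXn.
rewrite lm in hx1 hx2.
have hc : ip H x (shift_mx (M ^+ m) (l ^+ m)%:C%C ^+ k.-1 *m x) =
    ((l ^+ m.-1 *+ m) ^+ k.-1)%:C%C * sgn R e.
  rewrite hx2 ipZr; congr (_ * _); first by rewrite !rmorphXn /= rmorphMn /= rmorphXn.
  rewrite shift_mxX_ev; last by rewrite prednK.
  by rewrite leqnn subnn ip_Qm ?prednK // addn0 eqxx.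
have d0 : l ^+ m.-1 *+ m != 0 by rewrite mulrn_eq0 negb_or -lt0n m0 expf_neq0.
have hc0 : ip H x (shift_mx (M ^+ m) (l ^+ m)%:C%C ^+ k.-1 *m x) != 0.
  rewrite hc mulf_neq0 //; last by case: (e); rewrite /sgn ?oppr_eq0 oner_neq0.
  by rewrite fmorph_eq0 expf_neq0.
have [x' [_ h1 h2]] := real_normal (P := fun=> True) hH hM (fun _ _ _ _ _ => I) (fun _ _ => I)
    k0 I hx1 hc0.
have f := real_frame (tr_zero_form k) hM (selfadj_zero_form (M ^+ m)) h1 h2.
do 2 eexists; split; last exact: f.
move=> lp; rewrite hc pmulr_rgt0.
  by case: (e); rewrite /sgn ?ltr01 // oppr_gt0 ltr10.
by rewrite ltcR exprn_gt0 // pmulrn_lgt0.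
Qed.

(** Isotropy has to come from the two coordinate halves [P1] and [P2], since a^m may be real. Only
    the chain in the first half is normalized, the generator of the second being kept. *)
Lemma pow_cplx k (x y : R) m (a := (x +i* y)%C) : (0 < k)%N -> a != 0 -> (0 < m)%N ->
  exists (W : 'M[C]_(k + k, k + k)),
    frame (cfMmx (k + k) [:: inr (k, x, y)] ^+ m) (cfNmx (k + k) [:: inr (k, x, y)]) 0 W
      [:: inr (k, complex.Re (a ^+ m), complex.Im (a ^+ m))].
Proof.
move=> k0 a0 m0.
have hs : sumn (map (@cb_size R) [:: inr (k, x, y)]) = (k + k)%N by rewrite /= addn0 addnn.
have hM := selfadjX m (cfNmx_selfadj hs); have hH := cfNmx_adj (k + k) [:: inr (k, x, y)].
move: hM hH; rewrite cfMmx_inr cfNmx_inr -[(x -i* y)%C]/((a^*)%C) -/a.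
set M := block_mx (Jm _ _) _ _ _; set H := block_mx 0 _ _ _ => hM hH.
have hMm : M ^+ m = block_mx (Jm k a ^+ m) 0 0 (Jm k ((a^*)%C) ^+ m) by rewrite /M expr_block.
have nilM (b : C) i : shift_mx M b ^+ i =
    block_mx (shift_mx (Jm k a) b ^+ i) 0 0 (shift_mx (Jm k ((a^*)%C)) b ^+ i).
  by rewrite -expr_block /shift_mx /M scalar_mx_block opp_block_mx add_block_mx oppr0 !addr0.
pose u := col_mx (ev k k.-1) 0 : 'cV[C]_(k + k).
pose v := col_mx 0 (ev k k.-1) : 'cV[C]_(k + k).
have kk : (k.-1 < k)%N by rewrite prednK.
have kk' : (k <= k.-1)%N = false by lia.
have hu0 : shift_mx M a ^+ k *m u = 0.
  by rewrite nilM mul_block_col !mulmx0 !mul0mx !addr0 shift_mxX_ev // kk' col_mx0.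
have hv0 : shift_mx M ((a^*)%C) ^+ k *m v = 0.
  by rewrite nilM mul_block_col !mulmx0 !mul0mx !add0r shift_mxX_ev // kk' col_mx0.
have [hu1 hu2] := shift_mx_pow m0 k0 hu0.
have [hv1 _] := shift_mx_pow m0 k0 hv0.
have conjX : ((a^*)%C) ^+ m = ((a ^+ m)^*)%C by rewrite rmorphXn.
rewrite conjX in hv1.
have hc0 : ip H v (shift_mx (M ^+ m) (a ^+ m) ^+ k.-1 *m u) != 0.
  rewrite hu2 ipZr mulf_neq0 ?expf_neq0 // ?mulrn_eq0 ?negb_or -?lt0n ?m0 ?expf_neq0 //.
  rewrite nilM mul_block_col !mulmx0 !mul0mx !addr0 shift_mxX_ev // leqnn subnn.
  have -> : ip H v (col_mx (ev k 0) 0) = ip (Qm k 1) (ev k k.-1) (ev k 0).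
    rewrite /ip /v adj_col adjmx0 /H mul_row_block mul_row_col.
    by rewrite !(mulmx0, mul0mx, addr0, add0r).
  by rewrite ip_Qm // addn0 eqxx oner_neq0.
pose P1 (w : 'cV[C]_(k + k)) := dsubmx w = 0.
pose P2 (w : 'cV[C]_(k + k)) := usubmx w = 0.
have P1D b w w' : P1 w -> P1 w' -> P1 (b *: w + w').
  by rewrite /P1 linearD linearZ /= => -> ->; rewrite scaler0 addr0.
have P2D b w w' : P2 w -> P2 w' -> P2 (b *: w + w').
  by rewrite /P2 linearD linearZ /= => -> ->; rewrite scaler0 addr0.
have P1M w : P1 w -> P1 (M ^+ m *m w).
  rewrite /P1 -{2}[w]vsubmxK => ->.
  by rewrite hMm mul_block_col col_mxKd !mul0mx mulmx0 addr0.
have P2M w : P2 w -> P2 (M ^+ m *m w).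
  rewrite /P2 -{2}[w]vsubmxK => ->.
  by rewrite hMm mul_block_col col_mxKu !mul0mx mulmx0 addr0.
have P1i w w' : P1 w -> P1 w' -> ip H w w' = 0.
  rewrite /P1 -{2}[w]vsubmxK -{2}[w']vsubmxK => -> ->.
  rewrite /ip adj_col adjmx0 /H mul_row_block mul_row_col.
  by rewrite !(mulmx0, mul0mx, addr0, add0r) mxE.
have P2i w w' : P2 w -> P2 w' -> ip H w w' = 0.
  rewrite /P2 -{2}[w]vsubmxK -{2}[w']vsubmxK => -> ->.
  rewrite /ip adj_col adjmx0 /H mul_row_block mul_row_col.
  by rewrite !(mulmx0, mul0mx, addr0, add0r) mxE.
have P1u : P1 u by rewrite /P1 col_mxKd.
have P2v : P2 v by rewrite /P2 col_mxKu.
have [u' [P1u' h1 h2]] := pair_normal P1D P1M k0 P1u hu1 hc0.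
exists (row_mx (chain k (shift_mx (M ^+ m) (a ^+ m)) u') (chain k (shift_mx (M ^+ m) ((a ^+
    m)^*)%C) v)).
apply: (pair_frame hH (tr_zero_form _) hM (selfadj_zero_form _)) => //.
- by move=> i j; apply: P1i; apply: (shift_mx_stable P1D P1M).
- by move=> i j; apply: P2i; apply: (shift_mx_stable P2D P2M).
- by move=> i j; rewrite /bp mulmx0 mul0mx mxE.
Qed.
End UnitVectors.

(** * Powers of nilpotent blocks *)

(** The standard balanced sequence of length s with majority sign e; every balanced one is a
    rearrangement of it. *)
Definition bal_seq (e : bool) s := nseq (uphalf s) e ++ nseq s./2 (~~ e).

Lemma size_bal_seq e s : size (bal_seq e s) = s.
Proof. by rewrite size_cat !size_nseq uphalf_half -addnA addnn odd_double_half. Qed.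

Lemma bal_SS e s : perm_eq (bal_seq e s.+2) (true :: false :: bal_seq e s).
Proof.
apply/permP => p; case: e; rewrite /bal_seq /= !count_cat /= !count_nseq;
  by case: (p true); case: (p false) => /=; lia.
Qed.

Lemma balanced_bal e s : balanced e (bal_seq e s).
Proof.
rewrite /balanced size_bal_seq /bal_seq !count_cat !count_nseq /= eqxx uphalf_half.
by case: e; case: (odd s) => /=; lia.
Qed.

Lemma balanced_perm e s : balanced e s -> perm_eq s (bal_seq e (size s)).
Proof.
rewrite /balanced => h; apply/permP => p.
(* A boolean sequence is determined up to order by its two counts, and balance together with the
   length fixes both. *)
have cnt t : count p t = (p e * count (pred1 e) t + p (~~ e) * count (pred1 (~~ e)) t)%N.
  by elim: t => [|b t IH] /=; [lia|rewrite IH]; case: b; case: (e) => /=; lia.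
have hs : (count (pred1 e) s + count (pred1 (~~ e)) s)%N = size s.
  by elim: s {h} => [|b t IH] //=; move: IH; case: b; case: (e) => /=; lia.
have hb := balanced_bal e (size s).
have hs' : (count (pred1 e) (bal_seq e (size s)) + count (pred1 (~~ e)) (bal_seq e (size s)))%N
    = size s.
  by rewrite /bal_seq !count_cat !count_nseq /= eqxx; case: (e) => /=; have := size_bal_seq e
      (size s); rewrite size_cat !size_nseq; lia.
rewrite !cnt; move: hb h; rewrite /balanced size_bal_seq.
by case: ifP => _ /eqP hb /eqP h; congr (_ * _ + _ * _)%N; lia.
Qed.

Section ZeroBlock.
Variable R : realType.
Local Notation C := (R[i]).
Implicit Types (cf : seq (cblock R)).
Variables (m k : nat) (e : bool).
Hypothesis m0 : (0 < m)%N.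
Let B := Jm k (0 : C) ^+ m.
Let H := Qm k (sgn R e).

Lemma shift_mx0 p (M : 'M[C]_p) : shift_mx M 0 = M.
Proof. by rewrite /shift_mx raddf0 subr0. Qed.

Lemma Qm_adj : adj_mx H = H.
Proof. by have := @cfNmx_adj R k [:: inl (k, 0, e)]; rewrite cfNmx_inl. Qed.

Lemma JmX_selfadj : H *m B = adj_mx B *m H.
Proof.
have := selfadjX m (cfNmx_selfadj (addn0 k : sumn (map (@cb_size R) [:: inl (k, 0, e)]) = k)).
by rewrite cfNmx_inl cfMmx_inl.
Qed.

Lemma JmX_ev i j : (j < k)%N -> B ^+ i *m ev R k j = if (i * m <= j)%N then ev R k (j - i * m)
    else 0.
Proof.
by move=> hj; rewrite /B -exprM mulnC -[Jm k 0]shift_mx0 shift_mxX_ev.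
Qed.

(** J_k(0)^m moves indices by m, so vectors supported on given residue classes modulo m form a
    stable subspace. Supports record which pieces are orthogonal. *)
Definition class_supp k' (D : pred nat) (W : 'M[C]_(k, k')) := forall i : 'I_k, ~~ D (i %% m)%N
    -> row i W = 0.

Lemma supp_row k1 k2 D (W1 : 'M_(k, k1)) (W2 : 'M_(k, k2)) :
  class_supp D W1 -> class_supp D W2 -> class_supp D (row_mx W1 W2).
Proof. by move=> h1 h2 i hi; rewrite row_row_mx h1 // h2 // row_mx0. Qed.

Lemma supp_mul k1 k2 D (W : 'M_(k, k1)) (T : 'M_(k1, k2)) : class_supp D W -> class_supp D (W *m
    T).
Proof. by move=> h i hi; rewrite row_mul h // mul0mx. Qed.

Lemma supp_sub k' (D D' : pred nat) (W : 'M_(k, k')) : (forall i, D i -> D' i) ->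
  class_supp D W -> class_supp D' W.
Proof. by move=> hD h i hi; apply: h; apply: contra hi; apply: hD. Qed.

Lemma supp_chain (D : pred nat) l j (c : C) : (j < k)%N -> D (j %% m)%N -> class_supp D (chain l
    B (c *: ev R k j)).
Proof.
move=> hj hD i hi; apply/matrixP => i' t; rewrite mxE chainE -scalemxAr JmX_ev //.
case: ifP => h; rewrite !mxE ?mulr0 //.
case: eqP => hij; rewrite ?mulr0 //; case/negP: hi.
by rewrite hij; have := hD; rewrite -{1}(subnKC h) modnMDl.
Qed.

Lemma supp_orth (D D' : pred nat) k1 k2 (W1 : 'M_(k, k1)) (W2 : 'M_(k, k2)) :
  (forall i j, (i + j)%N = k.-1 -> D (i %% m)%N -> ~~ D' (j %% m)%N) ->
  class_supp D W1 -> class_supp D' W2 -> adj_mx W1 *m H *m W2 = 0.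
Proof.
move=> hDD h1 h2; apply/matrixP => i j; rewrite [LHS]mxE [RHS]mxE big1 // => l' _.
have [hl'|hl'] := boolP (D' (l' %% m)%N); last first.
  by have /matrixP/(_ 0 j) := h2 l' hl'; rewrite !mxE => ->; rewrite mulr0.
rewrite [X in X * _]mxE big1 ?mul0r // => l _.
rewrite [H l l']mxE antidiagE; case: eqP => hll; last by rewrite mulr0.
have [hl|hl] := boolP (D (l %% m)%N); first by case/negP: (hDD _ _ hll hl).
have /matrixP/(_ 0 i) := h1 l hl; rewrite !mxE => ->.
by rewrite conjc0 mul0r.
Qed.

(** Since k - 1 = m L + 2 lo + s - 1, the reversal of indices maps the residue range from lo to lo +
    s - 1 onto itself by reflection. *)
Lemma mirror lo s L i j : (lo + s <= m)%N -> (lo.*2 + s + m * L)%N = k ->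
  (i + j)%N = k.-1 -> (lo <= i %% m < lo + s)%N -> ((i %% m) + (j %% m))%N = (lo.*2 + s).-1.
Proof.
move=> hs hk hij hi.
have h1 : ((i %/ m) * m + j = L * m + ((lo.*2 + s).-1 - i %% m))%N.
  by have := divn_eq i m; lia.
have := congr1 (modn^~ m) h1; rewrite !modnMDl => ->.
by move: (i %% m)%N hi => d hi; rewrite modn_small; lia.
Qed.

Lemma self_zero lo L : (lo < m)%N -> (lo.*2 + 1 + m * L)%N = k ->
  exists k' (W : 'M_(k, k')), frame B H 0 W [:: inl (L.+1, 0, e)] /\
    class_supp (fun c => lo <= c < lo + 1)%N W.
Proof.
(* The largest index in the class of lo; reversal exchanges it with lo, so the top pairing is the
   sign e itself. *)
move=> hlo hk; pose j := (lo + m * L)%N.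
have hj : (j < k)%N by rewrite /j; lia.
have jm : (j %% m = lo)%N by rewrite /j addnC mulnC modnMDl modn_small.
pose x := 1 *: ev R k j.
exists L.+1, (chain L.+1 B x); split; last by apply: supp_chain => //; rewrite jm; lia.
have := @real_frame R k B H 0 (tr_zero_form R k) JmX_selfadj (selfadj_zero_form B) L.+1 0 e x.
rewrite shift_mx0; apply.
  rewrite /x scale1r JmX_ev //; case: ifP => //; rewrite /j; lia.
move=> i hi; rewrite /x scale1r JmX_ev //.
have him : (i * m <= j)%N by rewrite /j mulnC (leq_trans _ (leq_addl _ _)) // leq_mul2l; lia.
rewrite him ip_Qm //; last by lia.
congr (if _ then _ else _); rewrite /j /= in him *.
apply/eqP/eqP => h; first by (have h' : (i * m = m * L)%N by lia); move/eqP: h'; rewrite mulnC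
    eqn_pmul2l // => /eqP.
by rewrite h mulnC; lia.
Qed.

(** Two exchanged classes give isotropic chains dual to each other, a nonreal-type pair with
    eigenvalue 0, which [frame_split] turns into opposite signs. The factor [sgn R e] in x makes the
    pairing 1. *)
Lemma pair_zero c c' L : (c < m)%N -> (c' < m)%N -> c != c' -> (c + c' + 1 + m * L)%N = k ->
  exists k' (W : 'M_(k, k')), frame B H 0 W [:: inl (L.+1, 0, true); inl (L.+1, 0, false)] /\
    class_supp (fun i => (i == c) || (i == c')) W.
Proof.
move=> hc hc' hcc hk.
pose j := (c + m * L)%N; pose j' := (c' + m * L)%N.
have hj : (j < k)%N by rewrite /j; lia.
have hj' : (j' < k)%N by rewrite /j'; lia.
have jm : (j %% m = c)%N by rewrite /j addnC mulnC modnMDl modn_small.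
have jm' : (j' %% m = c')%N by rewrite /j' addnC mulnC modnMDl modn_small.
pose x := sgn R e *: ev R k j; pose z := 1 *: ev R k j'.
have ss : sgn R e * sgn R e = 1 by case: (e); rewrite /sgn ?mulrNN mulr1.
(* Two indices of one class d that sum to k - 1 would give 2 d = c + c' modulo m, hence c = c'. *)
have iso d a b (t : nat) (f g : C) : (d < m)%N -> (d == c) || (d == c') -> (t < k)%N -> (t %% m
    = d)%N ->
    ip H (B ^+ a *m (f *: ev R k t)) (B ^+ b *m (g *: ev R k t)) = 0.
  move=> hd hdd ht htd; rewrite -!scalemxAr ipZl ipZr !JmX_ev //.
  case: ifP => h1; last by rewrite ip0l !mulr0.
  case: ifP => h2; last by rewrite ip0r !mulr0.
  rewrite ip_Qm; [|lia|lia].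
  case: eqP => h; last by rewrite !mulr0.
  have h3 : (t + t = (L + a + b) * m + (c + c'))%N.
    rewrite !mulnDl (mulnC L); clear -h1 h2 h hk.
    by move: (a * m)%N (b * m)%N (m * L)%N h1 h2 h hk => am bm mL; lia.
  have /eqP := congr1 (modn^~ m) h3; rewrite modnMDl -modnDm htd.
  by case/orP: hdd => /eqP ->; rewrite ?eqn_modDl ?eqn_modDr !modn_small // => /eqP h4;
    rewrite h4 eqxx in hcc.
have f : frame B H 0 (row_mx (chain L.+1 B x) (chain L.+1 B z)) [:: inr (L.+1, 0, 0)].
  have := @pair_frame R k B H 0 Qm_adj (tr_zero_form R k) JmX_selfadj (selfadj_zero_form B) L.+1
      0 x z.
  rewrite conjc0 shift_mx0; apply.
  - rewrite /x -scalemxAr JmX_ev //; case: ifP; rewrite ?scaler0 // /j; lia.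
  - rewrite /z -scalemxAr JmX_ev //; case: ifP; rewrite ?scaler0 // /j'; lia.
  - move=> i hi; rewrite /x /z scale1r -scalemxAr JmX_ev // ipZr.
    have him : (i * m <= j)%N by rewrite /j mulnC (leq_trans _ (leq_addl _ _)) // leq_mul2l; lia.
    rewrite him ip_Qm //; last by lia.
    have -> : (j' + (j - i * m) == k.-1)%N = (i == L).
      rewrite /j /j' in him *; apply/eqP/eqP => h; last by rewrite h mulnC; lia.
      by have /eqP : (i * m = m * L)%N by [lia]; rewrite mulnC eqn_pmul2l // => /eqP.
    by rewrite /=; case: eqP => _; rewrite ?mulr0.
  - by move=> a b; apply: (iso c) => //; rewrite eqxx.
  - by move=> a b; apply: (iso c') => //; rewrite eqxx orbT.
  - by move=> a b; rewrite /bp mulmx0 mul0mx mxE.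
have [T hT] := frame_split L.+1 (0 : R).
do 2 eexists; split; first exact: (frame_comp f hT).
by apply/supp_mul/supp_row; apply: supp_chain; rewrite // ?jm ?jm' eqxx ?orbT.
Qed.

(** The two outermost classes are exchanged and contribute both signs; peeling them off leaves
    nothing or the middle class, which contributes e. *)
Lemma range_zero s lo L : (lo + s <= m)%N -> (lo.*2 + s + m * L)%N = k ->
  exists k' (W : 'M_(k, k')) cf, [/\ frame B H 0 W cf,
    class_supp (fun c => lo <= c < lo + s)%N W &
    perm_eq cf [seq inl (L.+1, 0, e') | e' <- bal_seq e s]].
Proof.
have [n] := ubnP s; elim: n s lo => // n IH [|[|s]] lo hn hs hk.
- exists 0%N, 0, [::]; split=> //; first exact: frame0.
  by move=> i _; apply/matrixP => ? [].
- have [|k' [W [f hW]]] := self_zero _ hk; first by lia.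
  by exists k', W, [:: inl (L.+1, 0, e)].
have [||||k1 [W1 [f1 s1]]] := @pair_zero lo (lo + s.+1)%N L; try lia.
have [|||k2 [W2 [cf2 [f2 s2 p2]]]] := IH s lo.+1; try lia.
exists _, (row_mx W1 W2), ([:: inl (L.+1, 0, true); inl (L.+1, 0, false)] ++ cf2); split.
- apply: (frame_cat Qm_adj (tr_zero_form R k) f1 f2); last by rewrite mulmx0 mul0mx.
  apply: supp_orth s1 s2 => i j hij hi.
  by have := mirror hs hk hij; move: hi; case/orP => /eqP ->; lia.
- by apply: supp_row; [apply: supp_sub s1|apply: supp_sub s2] => i /=; lia.
- rewrite (perm_trans _ (perm_map _ (_ : perm_eq (true :: false :: bal_seq e s) _))) //; last by
    rewrite perm_sym bal_SS.
  by rewrite /= !perm_cons.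
Qed.
End ZeroBlock.

(** * Block lists of powers and of roots *)

Section Powers.
Variable R : realType.
Local Notation C := (R[i]).
Implicit Types (cf : seq (cblock R)).
Variable m : nat.
Hypothesis m0 : (0 < m)%N.

Definition cf_size cf := sumn (map (@cb_size R) cf).

(* In [cf] a block [inr (k, x, y)] may have [y <= 0], so that any complex root of an eigenvalue
   can be used. *)
Definition powers cf cf' := exists p k' (T : 'M[C]_(p, k')),
  [/\ cf_size cf = p, cf_size cf' = p & frame (cfMmx p cf ^+ m) (cfNmx p cf) 0 T cf'].

Lemma cf_size_cat cf1 cf2 : cf_size (cf1 ++ cf2) = (cf_size cf1 + cf_size cf2)%N.
Proof. by rewrite /cf_size map_cat sumn_cat. Qed.

Lemma powers_cat cf1 cf2 cf1' cf2' : powers cf1 cf1' -> powers cf2 cf2' ->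
  powers (cf1 ++ cf2) (cf1' ++ cf2').
Proof.
move=> [p1 [k1 [T1 [s1 s1' f1]]]] [p2 [k2 [T2 [s2 s2' f2]]]].
exists (p1 + p2)%N, (k1 + k2)%N, (block_mx T1 0 0 T2); split; rewrite ?cf_size_cat ?s1 ?s2 ?s1'
    ?s2' //.
by rewrite cfMmx_cat // cfNmx_cat // expr_block; apply: dsum_frame.
Qed.

Lemma powers_nil : powers [::] [::].
Proof.
exists 0%N, 0%N, 0; split=> //; exact: frame0.
Qed.

Lemma powers_perm cf cf1 cf2 : perm_eq cf1 cf2 -> powers cf cf1 -> powers cf cf2.
Proof.
move=> hp [p [k [T [s1 s2 f]]]].
have [k' [T' f']] := frame_perm (cfNmx_adj p cf) (tr_zero_form R p) hp (ex_intro _ k (ex_intro _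
    T f)).
exists p, k', T'; split=> //; rewrite -s2; apply: perm_sumn; apply: perm_map.
by rewrite perm_sym.
Qed.

Lemma powers_comp cf cf1 cf2 q (T : 'M[C]_(q, q)) : cf_size cf1 = q -> powers cf cf1 ->
  frame (cfMmx q cf1) (cfNmx q cf1) 0 T cf2 -> powers cf cf2.
Proof.
move=> hq [p [k [W [s1 s2 f]]]] fT.
have hk : k = q by case: f => hk _ _ _; rewrite -hq -hk.
subst k; exists p, q, (W *m T); split=> //; last exact: frame_comp f fT.
by case: fT => hq' _ _ _; rewrite /cf_size hq' -s2 -hq.
Qed.

Lemma powers_real k (l : R) e : (0 < k)%N -> l != 0 ->
  exists e', (0 < l ^+ m.-1 -> e' = e) /\ powers [:: inl (k, l, e)] [:: inl (k, l ^+ m, e')].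
Proof.
move=> k0 l0; have [e' [W [he f]]] := pow_real e k0 l0 m0.
by exists e'; split=> //; exists k, k, W; split=> //; rewrite /cf_size /= addn0.
Qed.

Lemma powers_cplx k (x y : R) (a := (x +i* y)%C) : (0 < k)%N -> a != 0 ->
  powers [:: inr (k, x, y)] [:: inr (k, complex.Re (a ^+ m), complex.Im (a ^+ m))].
Proof.
move=> k0 a0; have [W f] := pow_cplx k0 a0 m0.
by exists (k + k)%N, (k + k)%N, W; split=> //; rewrite /cf_size /= addn0 addnn.
Qed.

Lemma powers_flip cf k (x y : R) : powers cf [:: inr (k, x, y)] -> powers cf [:: inr (k, x, - y)].
Proof.
move=> h; have [T fT] := frame_flip k x y.
by apply: (powers_comp _ h fT); rewrite /cf_size /= addn0 addnn.
Qed.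

Lemma powers_split cf k (x : R) : powers cf [:: inr (k, x, 0)] ->
  powers cf [:: inl (k, x, true); inl (k, x, false)].
Proof.
move=> h; have [T fT] := frame_split k x.
by apply: (powers_comp _ h fT); rewrite /cf_size /= addn0 addnn.
Qed.

Lemma cf_size_const L (s : seq bool) : cf_size [seq inl (L, 0, e) | e <- s] = (L * size s)%N.
Proof. by elim: s => [|b s IH] /=; rewrite ?muln0 // /cf_size /= -/(cf_size _) IH mulnS. Qed.

(** The residues below r and those from r on are each stable under reversal, so the two ranges split
    orthogonally, both with majority sign e. *)
Lemma powers_zero a r e : (0 < r <= m)%N ->
  powers [:: inl ((a * m + r)%N, 0, e)] (zero_group R a r (bal_seq e r ++ bal_seq e (m - r))).
Proof.
move=> /andP[r0 rm]; set k := (a * m + r)%N.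
rewrite /zero_group take_size_cat ?size_bal_seq // drop_size_cat ?size_bal_seq //.
have [|k1 [W1 [cf1 [f1 s1 p1]]]] := @range_zero R m k e m0 r 0 a rm.
  by rewrite /k; lia.
have hz : powers [:: inl (k, 0, e)] (cf1 ++ (if (0 < a)%N then [seq inl (a, 0, e0) | e0 <-
    bal_seq e (m - r)] else [::])).
  have hp1 : cf_size cf1 = (a.+1 * r)%N.
    by rewrite -[r in RHS](size_bal_seq e) -cf_size_const; apply: perm_sumn; apply: perm_map.
  case: posnP => [a0|a0].
    rewrite cats0; exists k, k1, W1; rewrite cfMmx_inl cfNmx_inl rmorph0; split=> //.
      by rewrite /cf_size /= addn0.
    by rewrite hp1 /k a0; lia.
  (* Chains in this range have length a, while [range_zero] counts from L + 1, whence a - 1; the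
     case a = 0, where the range is empty, was treated separately. *)
  have [||k2 [W2 [cf2 [f2 s2 p2]]]] := @range_zero R m k e m0 (m - r) r a.-1.
  - by lia.
  - by rewrite /k; case: (a) a0 => // b _; lia.
  rewrite prednK // in p2.
  suff h : powers [:: inl (k, 0, e)] (cf1 ++ cf2) by apply: powers_perm h; rewrite perm_cat2l.
  exists k, (k1 + k2)%N, (row_mx W1 W2); rewrite cfMmx_inl cfNmx_inl rmorph0; split.
  - by rewrite /cf_size /= addn0.
  - rewrite cf_size_cat hp1; have -> : cf_size cf2 = (a * (m - r))%N.
      by rewrite -[(m - r)%N in RHS](size_bal_seq e) -cf_size_const; apply: perm_sumn; apply:
          perm_map.
    by rewrite mulnBr mulSn /k; have := leq_mul (leqnn a) rm; lia.
  - apply: (frame_cat (Qm_adj _ k e) (tr_zero_form R k) f1 f2); last by rewrite mulmx0 mul0mx.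
    apply: supp_orth s1 s2 => i j hij hi.
    have hk : (0.*2 + r + m * a)%N = k by rewrite /k; lia.
    by have := mirror m0 (lo := 0) rm hk hij hi; lia.
by apply: powers_perm hz; rewrite perm_cat2r.
Qed.

End Powers.

(** * The two conditions on block lists *)

Section Conditions.
Variable R : realType.
Local Notation C := (R[i]).
Implicit Types (cf : seq (cblock R)).
Variable m : nat.
Hypothesis m0 : (0 < m)%N.

Lemma cond_neg_cat cf1 cf2 : cond_neg cf1 -> cond_neg cf2 -> cond_neg (cf1 ++ cf2).
Proof.
move=> [t1 [a1 p1]] [t2 [a2 p2]]; exists (t1 ++ t2); split; first by rewrite all_cat a1 a2.
by rewrite /neg_part filter_cat map_cat flatten_cat perm_cat.
Qed.
Lemma cond_zero_cat cf1 cf2 : cond_zero m cf1 -> cond_zero m cf2 -> cond_zero m (cf1 ++ cf2).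
Proof.
move=> [t1 [a1 p1]] [t2 [a2 p2]]; exists (t1 ++ t2); split; first by rewrite all_cat a1 a2.
by rewrite /zero_part filter_cat map_cat flatten_cat perm_cat.
Qed.
Lemma cond_neg_nil cf : neg_part cf = [::] -> cond_neg cf.
Proof. by move=> h; exists [::]; rewrite h. Qed.
Lemma cond_zero_nil cf : zero_part cf = [::] -> cond_zero m cf.
Proof. by move=> h; exists [::]; rewrite h. Qed.

Lemma complex_split (a : C) : a = (complex.Re a +i* complex.Im a)%C.
Proof. by case: a. Qed.

Lemma powers_block (b : cblock R) : cb_valid b -> exists cf,
  [/\ powers m [:: b] cf, all (@cb_valid R) cf, ~~ odd m -> cond_neg cf & cond_zero m cf].
Proof.
case: b => [[[k l] e]|[[k x] y]] /=.
  move=> k0; have [l0|l0] := eqVneq l 0.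
    (* Division of k - 1 rather than k, so that the remainder part r runs from 1 to m. *)
    rewrite {}l0; pose a := (k.-1 %/ m)%N; pose r := (k.-1 %% m).+1.
    have hk : k = (a * m + r)%N by have := divn_eq k.-1 m; rewrite /a /r; lia.
    have hr : (0 < r <= m)%N by rewrite /r /= ltn_mod.
    exists (zero_group R a r (bal_seq e r ++ bal_seq e (m - r))).
    have hz : zero_part (zero_group R a r (bal_seq e r ++ bal_seq e (m - r))) = zero_group R a r
        (bal_seq e r ++ bal_seq e (m - r)).
      apply/all_filterP; rewrite /zero_group all_cat all_map; apply/andP; split.
        by apply/allP => b _ /=.
      by case: ifP => // _; rewrite all_map; apply/allP => b _ /=.
    split.
    - by rewrite hk; apply: powers_zero.
    - rewrite /zero_group all_cat all_map; apply/andP; split; first by apply/allP.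
      by case: ifP => // a0; rewrite all_map; apply/allP.
    - move=> _; apply: cond_neg_nil; apply/eqP; rewrite -[_ == _]negbK -has_filter.
      rewrite -all_predC -hz; apply/allP => b; rewrite mem_filter.
      by case: b => [[[k' l'] e']|[[? ?] ?]] //= /andP[/eqP -> _]; rewrite ltxx.
    - exists [:: (a, r, bal_seq e r ++ bal_seq e (m - r))]; split; last by rewrite hz /= cats0.
      rewrite all_seq1; apply/and4P; split; first by case/andP: hr.
      + by case/andP: hr.
      + by rewrite size_cat !size_bal_seq subnKC //; case/andP: hr.
      + apply/existsP; exists e; rewrite take_size_cat ?size_bal_seq // drop_size_cat
          ?size_bal_seq //.
        by rewrite !balanced_bal.
  have [e' [_ hp]] := powers_real m0 e k0 l0.
  exists [:: inl (k, l ^+ m, e')]; split=> //=; rewrite ?k0 //.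
    (* An even power of a real eigenvalue is nonnegative: negative eigenvalues of the power arise
       only from nonreal pairs. *)
    move=> hm; apply: cond_neg_nil; rewrite /neg_part /= ltNge exprn_even_ge0 //.
  by apply: cond_zero_nil; rewrite /zero_part /= expf_eq0 (negPf l0) andbF.
move=> /andP[k0 y0]; pose a := (x +i* y)%C.
have a0 : a != 0 by rewrite eq_complex negb_and /= (gt_eqF y0) orbT.
have := powers_cplx m0 k0 a0; have := expf_neq0 m a0; rewrite -/a eq_complex.
move: (complex.Re (a ^+ m)) (complex.Im (a ^+ m)) => u v hne hp.
have [v0|v0|v0] := ltgtP v 0.
- exists [:: inr (k, u, - v)]; split; first exact: powers_flip.
  + by rewrite /= k0 oppr_gt0 v0.
  + by move=> _; apply: cond_neg_nil.
  + exact: cond_zero_nil.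
- exists [:: inr (k, u, v)]; split=> //.
  + by rewrite /= k0 v0.
  + by move=> _; apply: cond_neg_nil.
  + exact: cond_zero_nil.
rewrite v0 eqxx andbT in hp hne.
exists [:: inl (k, u, true); inl (k, u, false)]; split.
- exact: powers_split.
- by rewrite /= k0.
- move=> _; have [u0|u0] := ltP u 0.
    by exists [:: (k, u)]; split; rewrite /neg_part /= ?k0 u0.
  by apply: cond_neg_nil; rewrite /neg_part /= ltNge u0.
- by apply: cond_zero_nil; rewrite /zero_part /= (negPf hne).
Qed.

Lemma powers_exist cf : all (@cb_valid R) cf -> exists cf',
  [/\ powers m cf cf', all (@cb_valid R) cf', ~~ odd m -> cond_neg cf' & cond_zero m cf'].
Proof.
elim: cf => [|b cf IH] /=.
  by exists [::]; split=> // [|_|]; [exact: powers_nil|exact: cond_neg_nil|exact: cond_zero_nil].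
move=> /andP[/powers_block[cf1 [p1 v1 n1 z1]] /IH[cf2 [p2 v2 n2 z2]]].
exists (cf1 ++ cf2); split.
- by rewrite -cat1s; apply: powers_cat.
- by rewrite all_cat v1 v2.
- by move=> hm; apply: cond_neg_cat; [apply: n1|apply: n2].
- exact: cond_zero_cat.
Qed.

Definition rooted cf := exists cfA, powers m cfA cf.

Lemma rooted_cat cf1 cf2 : rooted cf1 -> rooted cf2 -> rooted (cf1 ++ cf2).
Proof. by move=> [c1 h1] [c2 h2]; exists (c1 ++ c2); apply: powers_cat. Qed.

Lemma rooted_flatten (T : eqType) (f : T -> seq (cblock R)) (s : seq T) :
  (forall t, t \in s -> rooted (f t)) -> rooted (flatten (map f s)).
Proof.
elim: s => [|t s IH] h /=; first by exists [::]; apply: powers_nil.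
apply: rooted_cat; first by apply: h; rewrite mem_head.
by apply: IH => u hu; apply: h; rewrite in_cons hu orbT.
Qed.

Lemma rooted_all (cf : seq (cblock R)) : (forall b, b \in cf -> rooted [:: b]) -> rooted cf.
Proof.
move=> h; have := rooted_flatten h.
by have -> : flatten (map (fun b => [:: b]) cf) = cf by elim: cf {h} => //= b cf ->.
Qed.

Lemma rooted_perm cf1 cf2 : perm_eq cf1 cf2 -> rooted cf2 -> rooted cf1.
Proof. by move=> hp [c h]; exists c; apply: powers_perm h; rewrite perm_sym. Qed.

Lemma real_root (l : R) : 0 < l -> exists2 t : R, 0 < t & t ^+ m = l.
Proof.
move=> l0; pose z := m.-root (l%:C%C : C).
have z0 : 0 < z by rewrite rootC_gt0 // ltcR.
have hz : z ^+ m = l%:C%C by rewrite rootCK.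
have zE : z = (complex.Re z)%:C%C by move: z0; case: (z) => u v; rewrite ltcE /= => /andP[/eqP
    -> _].
exists (complex.Re z); first by rewrite -ltcR -zE.
by apply: (@complexI R); rewrite rmorphXn /= -zE.
Qed.

Lemma rooted_cplx k (x y : R) : (0 < k)%N -> (x +i* y)%C != 0 -> rooted [:: inr (k, x, y)].
Proof.
move=> k0 a0; pose z := m.-root ((x +i* y)%C : C).
have hz : z ^+ m = (x +i* y)%C by rewrite rootCK.
have z0 : (complex.Re z +i* complex.Im z)%C != 0.
  by rewrite -complex_split; apply: contra_neq a0 => z0; rewrite -hz z0 expr0n gtn_eqF.
exists [:: inr (k, complex.Re z, complex.Im z)].
by have := powers_cplx m0 k0 z0; rewrite -complex_split hz.
Qed.

(** A real eigenvalue l is treated as the complex number l + 0 i: any complex root gives a pair with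
    power l, which splits into the two signs. *)
Lemma rooted_pair k (l : R) : (0 < k)%N -> l != 0 ->
  rooted [:: inl (k, l, true); inl (k, l, false)].
Proof.
move=> k0 l0; have [|c hc] := @rooted_cplx k l 0 k0.
  by rewrite eq_complex /= negb_and l0.
by exists c; apply: powers_split.
Qed.

(** The root t must satisfy t^(m-1) > 0 to keep the prescribed sign; for l < 0 and m odd the
    exponent m - 1 is even. *)
Lemma rooted_real k (l : R) e : (0 < k)%N -> 0 < l \/ (odd m /\ l < 0) ->
  rooted [:: inl (k, l, e)].
Proof.
move=> k0 hl.
have [t [t0 tm tl]] : exists t : R, [/\ t != 0, 0 < t ^+ m.-1 & t ^+ m = l].
  case: hl => [l0|[hm l0]].
    have [t t0 tm] := real_root l0.
    by exists t; rewrite gt_eqF // exprn_gt0.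
  have [|t t0 tm] := @real_root (- l); first by rewrite oppr_gt0.
  exists (- t); rewrite oppr_eq0 gt_eqF //; split=> //.
    have he : ~~ odd m.-1 by move: hm m0; case: (m).
    by rewrite exprNn -signr_odd (negPf he) mul1r exprn_gt0.
  by rewrite exprNn -signr_odd hm expr1 mulN1r tm opprK.
have [e' [he hp]] := powers_real m0 e k0 t0.
by rewrite (he tm) tl in hp; exists [:: inl (k, t, e)].
Qed.

(** A whole group comes from the single nilpotent block of size a m + r whose sign is the majority
    sign eta. *)
Lemma rooted_zero a r eps : (0 < r <= m)%N -> size eps = m ->
  (exists eta, balanced eta (take r eps) && balanced eta (drop r eps)) ->
  rooted (zero_group R a r eps).
Proof.
move=> hr hs [eta /andP[h1 h2]]; exists [:: inl ((a * m + r)%N, 0, eta)].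
apply: powers_perm (powers_zero R m0 a eta hr).
have /andP[_ rm] := hr.
have p1 := balanced_perm h1; have p2 := balanced_perm h2.
rewrite size_takel ?hs // in p1; rewrite size_drop hs in p2.
rewrite /zero_group take_size_cat ?size_bal_seq // drop_size_cat ?size_bal_seq //.
rewrite perm_sym; apply: perm_cat; first exact: perm_map.
by case: ifP => // _; apply: perm_map.
Qed.

Lemma perm_parts cf : perm_eq cf (neg_part cf ++ zero_part cf ++
  [seq b <- cf | if b is inl (_, l, _) then 0 < l else true]).
Proof.
apply/permP => p; rewrite !count_cat; elim: cf => [|b cf IH] //=; rewrite IH.
case: b => [[[k l] e]|[[k x] y]] /=; last by lia.
by case: (ltgtP l 0) => _ /=; lia.
Qed.

Lemma rooted_conditions cf : all (@cb_valid R) cf -> (~~ odd m -> cond_neg cf) ->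
  cond_zero m cf -> rooted cf.
Proof.
move=> /allP hv hn [gs [/allP hg hz]]; apply: rooted_perm (perm_parts cf) _.
apply: rooted_cat; [|apply: rooted_cat].
- have [hm|hm] := boolP (odd m).
    apply: rooted_all => b; rewrite mem_filter => /andP[hb /hv].
    by case: b hb => [[[k l] e]|[[k x] y]] //= l0 k0; apply: rooted_real => //; right.
  have [ts [/allP hts hp]] := hn hm; apply: rooted_perm hp _.
  apply: rooted_flatten => -[k l] /hts /= /andP[k0 l0].
  by apply: rooted_pair; rewrite ?lt_eqF.
- apply: rooted_perm hz _; apply: rooted_flatten => -[[a r] eps] /hg /and4P[r0 rm /eqP hs
    /existsP he].
  by apply: rooted_zero => //; rewrite r0.
- apply: rooted_all => b; rewrite mem_filter => /andP[hb /hv].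
  case: b hb => [[[k l] e]|[[k x] y]] /= hb; first by move=> k0; apply: rooted_real => //; left.
  by move=> /andP[k0 y0]; apply: rooted_cplx; rewrite // eq_complex negb_and /= (gt_eqF y0) orbT.
Qed.
End Conditions.

(** * Closure of Omega under products and inverses, and the equivalence *)

Section Conjugation.
Variable R : realType.
Local Notation C := (R[i]).

Lemma Omega_mul n (A B : 'M[C]_(n + n)) : in_Omega A -> in_Omega B -> in_Omega (A *m B).
Proof.
move=> /in_OmegaP hA /in_OmegaP hB; apply/in_OmegaP.
by rewrite -mulmxA hB mulmxA hA cconjM mulmxA.
Qed.

Lemma Omega_inv n (A : 'M[C]_(n + n)) : A \in unitmx -> in_Omega A -> in_Omega (invmx A).
Proof.
move=> uA /in_OmegaP hA; apply/in_OmegaP; apply: (can_inj (mulKmx uA)).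
by rewrite (mulKVmx uA) mulmxA hA -mulmxA -cconjM (mulmxV uA) cconj1 mulmx1.
Qed.

End Conjugation.

Theorem mainTheorem5 (R : realType) (n m : nat) (B H : 'M[complex R]_(n + n)) :
  (1 <= m)%N -> in_Omega B -> in_Omega H -> H \in unitmx -> is_hermitian_mx H ->
  H_selfadjoint H B ->
  ((exists A : 'M[complex R]_(n + n), [/\ in_Omega A, H_selfadjoint H A & A ^+ m = B]) <->
   (exists (S : 'M[complex R]_(n + n)) (cf : seq (cblock R)),
      [/\ canonical_reduction B H S cf,
          (~~ odd m -> cond_neg cf) & cond_zero m cf])).
Proof.
move=> m0 OB OH uH hH hB; split.
  move=> [A [OA hA hAB]].
  have [W [cf [fW vW]]] := canonical_frame_exists OA OH uH hH hA.
  have [cf' [[p [k [T [sp sk fT]]]] v' n' z']] := powers_exist m0 vW.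
  have hp : p = n by case: fW => h _ _ _; rewrite -sp -h.
  move: T sp sk fT; rewrite hp => T sp sk fT.
  have hk : k = n by case: fT => h _ _ _; rewrite -h.
  move: T fT; rewrite hk => T fT; have f := frame_compX fW fT; rewrite hAB in f.
  by exists (qframe (W *m T)), cf'; split=> //; apply: frame_canonical.
move=> [S [cf [hcr hn hz]]].
have [W [SE fW]] := canonical_frame hcr.
have [_ uS vcf scf _] := hcr; rewrite SE in uS.
have [cfA [p [k [T [sp sk fT]]]]] := rooted_conditions m0 vcf hn hz.
have hp : p = n by rewrite -sk.
move: T sp sk fT; rewrite hp => T sp sk fT.
have hk : k = n by case: fT => h _ _ _; rewrite -h.
move: T fT; rewrite hk => T fT.
set N := cfNmx n cfA in fT; set M := cfMmx n cfA in fT.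
have uT : T \in unitmx by have /mulmx1_unit[] := frame_inj fT.
have [_ fT2 fT3 _] := fT.
(* T identifies (M^m, N) with the block pair of [cf]. Carrying M itself along gives an m-th root of
   that block matrix, selfadjoint for its form. *)
pose A1 := invmx T *m M *m T.
have TA1 : M *m T = T *m A1 by rewrite /A1 mulmxA mulKVmx.
have A1m : A1 ^+ m = cfMmx n cf.
  apply: (can_inj (mulKmx uT)).
  by rewrite -(intertwineX m TA1) fT2.
have A1sa : cfNmx n cf *m A1 = adj_mx A1 *m cfNmx n cf.
  rewrite -fT3 -mulmxA -TA1 !mulmxA -adjmxM -TA1 adjmxM.
  by rewrite -[adj_mx T *m N *m M]mulmxA (cfNmx_selfadj sp) !mulmxA.
(* Pairing the root with its conjugate puts it in Omega; the form is real, so the conjugate is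
   selfadjoint for it too. *)
pose D := block_mx A1 0 0 (cconj_mx A1).
pose G := block_mx (cfNmx n cf) 0 0 (cfNmx n cf).
have OD : in_Omega D by exists A1, 0; rewrite cconj0 oppr0.
have GD : G *m D = adj_mx D *m G.
  apply: dsum_selfadj => //; rewrite -[X in X *m _]cfNmx_cconj -cconjM A1sa cconjM cfNmx_cconj.
  by rewrite /adj_mx cconjT.
set S' := qframe W in uS.
pose A := S' *m D *m invmx S'.
have AS : A *m S' = S' *m D by rewrite /A mulmxKV.
have OA : in_Omega A.
  by apply: Omega_mul; [apply: Omega_mul => //|apply: Omega_inv => //]; apply: qframe_Omega.
clearbody A; exists A; split=> //.
- have hG := qframe_gram OH fW.
  have uS' : adj_mx S' \in unitmx.
    have := congr1 (@adj_mx R _ _) (mulmxV uS); rewrite adjmxM adjmx1.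
    by case/mulmx1_unit.
  (* Multiplying by S'^* on the left and by S' on the right turns the claim into selfadjointness of
     D for G. *)
  apply: (can_inj (mulKmx uS')); apply: (can_inj (mulmxK uS)).
  rewrite -/S' -/G in hG.
  rewrite -!mulmxA AS !mulmxA hG -adjmxM AS adjmxM.
  by rewrite -[_ *m H]mulmxA -[_ *m S']mulmxA hG.
- apply: (can_inj (mulmxK uS)).
  by rewrite (intertwineX m AS) (qframe_mul OB fW) /D expr_block -A1m cconjX.
Qed.
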